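(* Let $G = \langle X \mid R\rangle$ be either a free group freely generated by $X$, or a virtually free Coxeter group given by its standard Coxeter presentation with generating set $X$. Let $S = X^{\pm 1}$ and let $g_1,\ldots,g_n\in G$. Then the sequence $(\|g_1^k\cdots g_n^k\|_S)_k$ is uniformly semi-arithmetic. Moreover, the limit $$\tau_S(g_1,\ldots,g_n) := \lim_{k\to\infty}\frac{\|g_1^k\cdots g_n^k\|_S}{k}$$ exists and is equal to $\frac{d}{m}\in\mathbf{Q}$, where $m>0$ is the period and $d\geq 0$ is the difference of the uniformly semi-arithmetic sequence $(\|g_1^k\cdots g_n^k\|_S)_k$.
   Context: Conjugation-invariant word norm: for a group $G$ normally generated by a subset $S$ and $g\in G$, $$\|g\|_S := \inf\{\ell : g_1 s_1 g_1^{-1}\cdots g_\ell s_\ell g_\ell^{-1} = g,\ g_i\in G,\ s_i\in S\},$$ i.e. the word norm of $g$ associated with the set $\bar S=\bigcup_{s\in S}\mathrm{Conj}(s)$ of all conjugates of elements of $S$ (so $\|1\|_S=0$). Here $X^{\pm1}$ is the set of generators in $X$ together with their inverses. The standard Coxeter presentation of a Coxeter group with generating set $X$ is $\langle X \mid x^2=1,\ (xy)^{m_{xy}}=1 \ (x\ne y)\rangle$ with $m_{xy}=m_{yx}\in\{2,3,\ldots\}\cup\{\infty\}$ (no relation for $x,y$ when $m_{xy}=\infty$). A group is virtually free if it has a free subgroup of finite index. Sequences are indexed by $k\in\mathbf{N}=\{0,1,2,\ldots\}$. Let $\widehat{\mathbf{N}}=\mathbf{N}\cup\{\infty\}$ with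 the usual total order and $x+\infty=\infty+x=\infty$. A sequence $(a_k)_k$ in $\widehat{\mathbf{N}}$ is arithmetic with difference $d\ge0$ ($d\in\mathbf{N}$) if $a_{k+1}=a_k+d$ for all $k$; the constant sequence $\infty$ is arithmetic with difference $d$ for every $d\geq 0$. It is eventually arithmetic with difference $d$ if $(a_{k+N})_k$ is arithmetic with difference $d$ for some $N\ge0$. It is uniformly semi-arithmetic with period $m>0$ ($m\in\mathbf{N}$) and difference $d\geq 0$ if for every $r\ge0$ the sequence $(a_{mk+r})_k$ is eventually arithmetic with difference $d$ (the same $d$ for all $r$). It is uniformly semi-arithmetic if it is so for some period $m>0$ and difference $d\geq 0$. *)

(* Defs.v *)
From mathcomp Require Import all_boot all_order all_algebra.
From mathcomp Require Import all_classical all_reals all_analysis.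

Set Implicit Arguments.
Unset Strict Implicit.
Unset Printing Implicit Defensive.

Import numFieldNormedType.Exports.

Local Open Scope classical_set_scope.

(** * Presentations *)

(* The letter (x, true) stands for x and (x, false) for its formal inverse. *)
Definition word (X : Type) := seq (X * bool).

Inductive word_eq (X : Type) (R : set (word X)) : word X -> word X -> Prop :=
| word_eq_refl u : word_eq R u u
| word_eq_sym u v : word_eq R u v -> word_eq R v u
| word_eq_trans u v w : word_eq R u v -> word_eq R v w -> word_eq R u w
| word_eq_cancel u v x e :
    word_eq R (u ++ (x, e) :: (x, ~~ e) :: v) (u ++ v)
| word_eq_relator u v r : R r -> word_eq R (u ++ r ++ v) (u ++ v).

Definition letter_val (G : groupType) (X : Type) (f : X -> G) (l : X * bool) : G :=
  if l.2 then f l.1 else (f l.1)^-1%g.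

Definition word_val (G : groupType) (X : Type) (f : X -> G) (w : word X) : G :=
  (\prod_(l <- w) letter_val f l)%g.

(* The subset H of G is the subgroup generated by the family f, and the map
   from words to H induces an isomorphism from < X | R > onto H. *)
Definition presents (G : groupType) (H : set G) (X : Type) (f : X -> G)
    (R : set (word X)) : Prop :=
  range (word_val f) = H /\
  forall u v : word X, word_val f u = word_val f v <-> word_eq R u v.

Definition freely_generates (G : groupType) (H : set G) (X : Type) (f : X -> G) :=
  presents H f set0.

Definition finite_index (G : groupType) (H : set G) : Prop :=
  finite_set (range (fun g : G => [set (g * h)%g | h in H])).

Definition virtually_free (G : groupType) : Prop :=
  exists H : set G, finite_index H /\
    exists (B : Type) (b : B -> G), freely_generates H b.

(** * Coxeter groups *)

(* m x y = None encodes an infinite label; diagonal entries are never used. *)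
Definition coxeter_labels (X : Type) (m : X -> X -> option nat) : Prop :=
  forall x y : X, x <> y ->
    m x y = m y x /\ forall p : nat, m x y = Some p -> (2 <= p)%N.

Inductive coxeter_relator (X : Type) (m : X -> X -> option nat) : word X -> Prop :=
| coxeter_square x : coxeter_relator m [:: (x, true); (x, true)]
| coxeter_braid x y p : x <> y -> m x y = Some p ->
    coxeter_relator m (flatten (nseq p [:: (x, true); (y, true)])).

Definition coxeter_presentation (G : groupType) (X : Type) (f : X -> G) : Prop :=
  exists m : X -> X -> option nat,
    coxeter_labels m /\ presents [set: G] f (coxeter_relator m).

(** * Sequences in N extended with infinity, encoded as [None] *)

Definition enat := option nat.

Definition enat_add (a : enat) (d : nat) : enat := omap (addn^~ d) a.

Definition enat_inf (A : set nat) : enat :=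
  if pselect (exists l : nat, `[< A l >]) is left A_ex then Some (ex_minn A_ex)
  else None.

Definition enat_to_ereal (R : realType) (a : enat) : \bar R :=
  if a is Some l then (l%:R%R)%:E%E else +oo%E.

Definition arithmetic (d : nat) (a : nat -> enat) : Prop :=
  forall k, a k.+1 = enat_add (a k) d.

Definition eventually_arithmetic (d : nat) (a : nat -> enat) : Prop :=
  exists N : nat, arithmetic d (fun k => a (k + N)%N).

Definition uniformly_semi_arithmetic_with (m d : nat) (a : nat -> enat) : Prop :=
  (0 < m)%N /\
  forall r : nat, eventually_arithmetic d (fun k => a (m * k + r)%N).

Definition uniformly_semi_arithmetic (a : nat -> enat) : Prop :=
  exists m d : nat, uniformly_semi_arithmetic_with m d a.

(** * The conjugation-invariant word norm *)

Definition conj_norm (G : groupType) (S : set G) (g : G) : enat :=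
  enat_inf [set l | exists h s : 'I_l -> G, (forall i, S (s i)) /\
    (\prod_(i < l) (h i * s i * (h i)^-1))%g = g].

Definition pm_set (G : groupType) (X : Type) (f : X -> G) : set G :=
  [set g | exists x : X, g = f x \/ g = (f x)^-1%g].

Definition power_norm (G : groupType) (S : set G) (n : nat) (g : 'I_n -> G)
    (k : nat) : enat :=
  conj_norm S (\prod_(i < n) g i ^+ k)%g.

(* The value at k = 0 is a junk 0, irrelevant for the limit. *)
Definition power_norm_ratio (R : realType) (G : groupType) (S : set G) (n : nat)
    (g : 'I_n -> G) (k : nat) : \bar R :=
  (enat_to_ereal R (power_norm S g k) * (k%:R^-1)%:E)%E.

Definition tau (R : realType) (G : groupType) (S : set G) (n : nat)
    (g : 'I_n -> G) : \bar R :=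
  lim (power_norm_ratio R S g @ \oo).

(* Main.v *)
(** Deleting letters computes the norm: for a word [w], the norm of its value is
    the least number of letters whose deletion leaves a word representing 1.  This
    rests on an exchange property (if a word represents a conjugate of a letter,
    one of its letters can be deleted to leave a word representing 1), which comes
    from a signed count of the letters of a word by the conjugate they define, and
    on the fact that the two sides of a braid relation allow the same deletions up
    to their number.

    In a virtually free group, every word over a finite set that represents 1 has a
    binary bracketing whose brackets take their values in a fixed finite set.  Hence
    the vectors (k_1, ..., k_n, l) such that deleting l letters from
    w_1^k_1 ... w_n^k_n can leave a word representing 1 are generated by a
    context-free grammar, and by Parikh's theorem they form a semilinear set.  Cutting
    with k_1 = ... = k_n (Dickson's lemma) leaves a semilinear subset of N^2, whose
    lower envelope is eventually arithmetic on residue classes; the differences agree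
    because the norm grows by a bounded amount at each step. *)

Require Import Defs.
From mathcomp Require Import all_boot all_order all_algebra.
From mathcomp Require Import all_classical all_reals all_analysis.
From mathcomp Require Import zify ring.
Import numFieldNormedType.Exports.
Local Open Scope classical_set_scope.
Local Open Scope ring_scope.

Set Implicit Arguments.
Unset Strict Implicit.
Unset Printing Implicit Defensive.
Import Order.TTheory GRing.Theory Num.Theory.

(** * Semilinear sets *)

(** The definition of the norm lets conjugators range over the whole group; deletion from one fixed
    word leaves a finite choice of letters, which a grammar can describe. The exchange property has
    to cover letters with and without a sign: counts are compared exactly when there are no relators
    and modulo 2 for Coxeter relators, where a letter equals its inverse.

    Words w_1^k...w_n^k with a common exponent do not in general form a context-free language, so
    the exponents are first left independent and equated only on the commutative image, where
    equality is linear. Nothing is lost by forgetting the order: nonterminals carry an interval of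
    factor indices, so the choices come sorted, and a sorted sequence of indices is determined by
    its counts.

    The bracketing is inherited from a free subgroup of finite index. There it records how free
    reduction cancels letters; Schreier rewriting, run as a finite transducer, carries it back to
    the ambient group, and the finitely many states bound the values of the brackets. *)

Section Semilinear.
Variable V : nmodType.
Implicit Types (S T : V -> Prop) (P : seq V).

Inductive nspan P : V -> Prop :=
| nspan0 : nspan P 0
| nspanS p v : p \in P -> nspan P v -> nspan P (p + v).

Definition linear_set (bP : V * seq V) (v : V) : Prop :=
  exists2 u, nspan bP.2 u & v = bP.1 + u.

Definition semilinear S : Prop :=
  exists L : seq (V * seq V),
    forall v, S v <-> exists2 bP, bP \in L & linear_set bP v.

Lemma nspanD P u v : nspan P u -> nspan P v -> nspan P (u + v).
Proof.
move=> Pu Pv; elim: Pu => [|p w Pp _ IH]; first by rewrite add0r.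
by rewrite -addrA; apply: nspanS.
Qed.

Lemma nspanMn P p n : p \in P -> nspan P (p *+ n).
Proof.
move=> Pp; elim: n => [|n IH]; first by rewrite mulr0n; constructor.
by rewrite mulrS; apply: nspanS.
Qed.

Lemma nspan_sub P P' v : {subset P <= P'} -> nspan P v -> nspan P' v.
Proof.
by move=> PP'; elim=> [|p w /PP' ? _ IH]; [constructor | apply: nspanS].
Qed.

Lemma nspan_cat P P' v :
  nspan (P ++ P') v <-> exists u w, [/\ nspan P u, nspan P' w & v = u + w].
Proof.
split=> [|[u [w [Pu Pw ->]]]].
  elim=> [|p {}v + _ [u [w [Pu Pw ->]]]].
    by exists 0, 0; split; [constructor | constructor | rewrite addr0].
  rewrite mem_cat => /orP[Pp|Pp].
    by exists (p + u), w; split; [apply: nspanS | | rewrite addrA].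
  by exists u, (p + w); split; [| apply: nspanS | rewrite addrCA].
by apply: nspanD; [move: Pu | move: Pw]; apply: nspan_sub => x xP;
  rewrite mem_cat xP ?orbT.
Qed.

Lemma semilinear_ext S T :
  (forall v, S v <-> T v) -> semilinear S -> semilinear T.
Proof. by move=> ST [L SL]; exists L => v; rewrite -ST. Qed.

Lemma semilinear_linear b P : semilinear (linear_set (b, P)).
Proof.
exists [:: (b, P)] => v; split=> [?|[bP]]; last by rewrite inE => /eqP ->.
by exists (b, P); rewrite ?mem_head.
Qed.

Lemma semilinear1 b : semilinear (fun v => v = b).
Proof.
apply: (semilinear_ext _ (semilinear_linear b [::])) => v; split.
  by case=> u /= [|p w]; rewrite ?addr0 // in_nil.
by move=> ->; exists 0; rewrite ?addr0 //; constructor.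
Qed.

Lemma semilinear0 : semilinear (fun=> False).
Proof. by exists [::] => v; split=> // -[]. Qed.

Lemma semilinearU S T :
  semilinear S -> semilinear T -> semilinear (fun v => S v \/ T v).
Proof.
move=> [L SL] [K TK]; exists (L ++ K) => v; rewrite SL TK; split.
  by case=> -[bP bPi ?]; exists bP; rewrite // mem_cat bPi ?orbT.
by case=> bP; rewrite mem_cat => /orP[] ? ?; [left | right]; exists bP.
Qed.

Lemma semilinear_bigU (I : eqType) (s : seq I) (F : I -> V -> Prop) :
  (forall i, i \in s -> semilinear (F i)) ->
  semilinear (fun v => exists2 i, i \in s & F i v).
Proof.
elim: s => [|i s IH] slF.
  by apply: semilinear_ext semilinear0 => v; split=> // -[].
have slFi : semilinear (F i) by apply: slF; rewrite mem_head.
have slFs : semilinear (fun v => exists2 i, i \in s & F i v).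
  by apply: IH => j js; apply: slF; rewrite inE js orbT.
apply: semilinear_ext (semilinearU slFi slFs) => v; split.
  case=> [?|[j js ?]]; first by exists i; rewrite // mem_head.
  by exists j; rewrite // inE js orbT.
by case=> j; rewrite inE => /orP[/eqP->|js] ?; [left | right; exists j].
Qed.

Lemma semilinear_ind (p : (V -> Prop) -> Prop) :
  (forall S T, (forall v, S v <-> T v) -> p S -> p T) ->
  p (fun=> False) -> (forall S T, p S -> p T -> p (fun v => S v \/ T v)) ->
  (forall b P, p (linear_set (b, P))) -> forall S, semilinear S -> p S.
Proof.
move=> p_ext p0 pU p1 S [L SL].
apply: (p_ext (fun v => exists2 bP, bP \in L & linear_set bP v)).
  by move=> v; rewrite SL.
elim: L {SL} => [|[b P] L IH]; first by apply: p_ext p0 => v; split=> // -[].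
apply: p_ext (pU _ _ (p1 b P) IH) => v; split.
  case=> [?|[bP LbP ?]]; first by exists (b, P); rewrite // mem_head.
  by exists bP; rewrite // inE LbP orbT.
by case=> bP; rewrite inE => /orP[/eqP->|?] ?; [left | right; exists bP].
Qed.

Definition sumset S T v := exists u w, [/\ S u, T w & v = u + w].

Lemma semilinear_sum S T : semilinear S -> semilinear T ->
  semilinear (sumset S T).
Proof.
move=> slS slT; move: S slS; apply semilinear_ind.
- move=> S S' SS'; apply: semilinear_ext => v.
  by split=> -[u [w [? ? ->]]]; exists u, w; split=> //; apply/SS'.
- by apply: semilinear_ext semilinear0 => v; split=> // -[u [w []]].
- move=> S S' slS slS'; apply: semilinear_ext (semilinearU slS slS') => v.
  split; first by case=> -[u [w [? ? ->]]]; exists u, w; split=> //; [left | right].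
  by move=> [u [w [[?|?] ? ->]]]; [left | right]; exists u, w.
move=> b P; move: T slT; apply semilinear_ind.
- move=> S S' SS'; apply: semilinear_ext => v.
  by split=> -[u [w [? ? ->]]]; exists u, w; split=> //; apply/SS'.
- by apply: semilinear_ext semilinear0 => v; split=> // -[u [w []]].
- move=> S S' slS slS'; apply: semilinear_ext (semilinearU slS slS') => v.
  split; first by case=> -[u [w [? ? ->]]]; exists u, w; split=> //; [left | right].
  by move=> [u [w [? [?|?] ->]]]; [left | right]; exists u, w.
move=> c Q; apply: (semilinear_ext _ (semilinear_linear (b + c) (P ++ Q))) => v.
split.
  case=> u /nspan_cat[u1 [u2 [Pu1 Qu2 ->]]] ->.
  by exists (b + u1), (c + u2); rewrite addrACA; split=> //; eexists; eauto.
move=> [_ [_ [[/= u ? ->] [/= w ? ->] ->]]].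
by rewrite addrACA; exists (u + w) => //; apply/nspan_cat; exists u, w.
Qed.

Definition star S v := exists2 s : seq V, forall u, u \in s -> S u & v = \sum_(u <- s) u.

Lemma star_sum S T v :
  star (fun v => S v \/ T v) v <-> sumset (star S) (star T) v.
Proof.
split=> [[s]|[_ [_ [[s Ss ->] [t Tt ->] ->]]]]; last first.
  exists (s ++ t); last by rewrite big_cat.
  by move=> u; rewrite mem_cat => /orP[/Ss|/Tt]; [left | right].
elim: s v => [|u s IH] v Ss ->.
  exists 0, 0; rewrite addr0 big_nil; split=> //.
    by exists [::]; rewrite ?big_nil.
  by exists [::]; rewrite ?big_nil.
have [||u1 [u2 [[s1 ? e1] [s2 ? e2] e]]] := IH (\sum_(u <- s) u).
- by move=> w ws; apply: Ss; rewrite inE ws orbT.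
- by [].
have [Su|Tu] := Ss u (mem_head _ _).
  exists (u + u1), u2; split; [|by exists s2|by rewrite big_cons e addrA].
  exists (u :: s1); last by rewrite big_cons e1.
  by move=> w; rewrite inE => /orP[/eqP->//|]; auto.
exists u1, (u + u2); split; [by exists s1| |by rewrite big_cons e addrCA].
exists (u :: s2); last by rewrite big_cons e2.
by move=> w; rewrite inE => /orP[/eqP->//|]; auto.
Qed.

(** Commutativity splits the star of a union into a sum of stars, which leaves one linear set. A
    nonempty sum of its elements contains the base at least once, and all further copies of the base
    act as one more period. *)
Lemma semilinear_star S : semilinear S -> semilinear (star S).
Proof.
move: S; apply semilinear_ind.
- move=> S T ST; apply: semilinear_ext => v.
  by split=> -[s Ss ->]; exists s => // u /Ss /ST.
- apply: semilinear_ext (semilinear1 0) => v; split.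
    by move=> ->; exists [::]; rewrite ?big_nil.
  case=> -[|u s] F ->; first by rewrite big_nil.
  by case: (F u); rewrite mem_head.
- move=> S T slS slT; apply: semilinear_ext (semilinear_sum slS slT) => v.
  by rewrite star_sum.
move=> b P.
apply: semilinear_ext
  (semilinearU (semilinear1 0) (semilinear_linear b (b :: P))) => v; split.
  case=> [->|[u]]; first by exists [::]; rewrite ?big_nil.
  rewrite /= -cat1s => /nspan_cat[u1 [u2 [b1 Pu2 ->]]] ->.
  elim: b1 => [|p w + _ [s Ss e]].
    exists [:: b + u2]; last by rewrite big_seq1 add0r.
    by move=> x; rewrite inE => /eqP ->; exists u2.
  rewrite inE => /eqP ->; exists (b :: s); last by rewrite big_cons -e !addrA.
  move=> x; rewrite inE => /orP[/eqP->|/Ss//].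
  by exists 0; rewrite ?addr0 //; constructor.
case=> -[|u s] Ss ->; first by left; rewrite big_nil.
right; have [|w Pw ->] := Ss u; first exact: mem_head.
rewrite big_cons /= -addrA; eexists; last by [].
apply: nspanD; first by apply: nspan_sub Pw => x xP; rewrite inE xP orbT.
have {}Ss x : x \in s -> linear_set (b, P) x.
  by move=> xs; apply: Ss; rewrite inE xs orbT.
elim: s Ss => [|x s IH] Ss; first by rewrite big_nil; constructor.
have [|y Py ->] := Ss x; first exact: mem_head.
rewrite big_cons; apply: nspanD; last first.
  by apply: IH => z zs; apply: Ss; rewrite inE zs orbT.
apply: nspanS; first exact: mem_head.
by apply: nspan_sub Py => z zP; rewrite inE zP orbT.
Qed.

End Semilinear.

Lemma semilinear_image (V W : nmodType) (f : V -> W) (S : V -> Prop) :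
  f 0 = 0 -> {morph f : x y / x + y} ->
  semilinear S -> semilinear (fun w => exists2 v, S v & w = f v).
Proof.
move=> f0 fD; move: S; apply semilinear_ind.
- move=> S T ST; apply: semilinear_ext => v.
  by split=> -[u /ST Su ->]; exists u.
- by apply: semilinear_ext (@semilinear0 _) => v; split=> // -[].
- move=> S T slS slT; apply: semilinear_ext (semilinearU slS slT) => v; split.
    by case=> -[u ? ->]; exists u => //; [left | right].
  by case=> u [?|?] ->; [left | right]; exists u.
move=> b P; apply: semilinear_ext (semilinear_linear (f b) (map f P)) => w; split.
  case=> u /= Pu ->.
  suff [v Pv ->] : exists2 v, nspan P v & u = f v.
    by exists (b + v); rewrite ?fD //; exists v.
  elim: Pu => [|_ v /mapP[p Pp ->] _ [x Px ->]].
    by exists 0; rewrite ?f0 //; constructor.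
  by exists (p + x); rewrite ?fD //; apply: nspanS.
case=> _ [u /= Pu ->] ->; rewrite fD; exists (f u) => //=.
elim: Pu => [|p v Pp _ IH]; first by rewrite f0; constructor.
by rewrite fD; apply: nspanS => //; apply: map_f.
Qed.

(* Dickson's lemma, for the coordinates listed in [s]. *)
Lemma finite_basis (I : eqType) (s : seq I) (S : (I -> nat) -> Prop) :
  exists F : seq (I -> nat),
    (forall i, (i < size F)%N -> S (nth (fun=> 0%N) F i)) /\
    forall a, S a -> exists i, (i < size F)%N /\
      forall j, j \in s -> (nth (fun=> 0%N) F i j <= a j)%N.
Proof.
elim: s S => [|i s IH] S.
  have [[a Sa]|nS] := pselect (exists a, S a).
    exists [:: a]; split; first by case.
    by move=> b _; exists 0%N.
  by exists [::]; split=> // a Sa; case: nS; exists a.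
have [F [FS domF]] := IH S.
(* [H] bounds the entries at [i] of the basis for [s], so a vector with entry at least [H] dominates
   its basis vector at [i] as well; the finitely many slices with a smaller entry are added one by
   one. *)
pose H := \max_(b < size F) nth (fun=> 0%N) F b i.
have [K [KS domK]] : exists F : seq (I -> nat),
   (forall i, (i < size F)%N -> S (nth (fun=> 0%N) F i)) /\
   forall a, S a -> (a i < H)%N -> exists k, (k < size F)%N /\
      forall j, j \in i :: s -> (nth (fun=> 0%N) F k j <= a j)%N.
  elim: (H) => [|h [F' [F'S domF']]]; first by exists [::].
  clear F FS domF H; move: F' F'S domF' => F FS domF.
  have [K [KS domK]] := IH (fun a => S a /\ a i = h).
  exists (F ++ K); split=> [k|a Sa]; rewrite size_cat.
    move=> kFK; rewrite nth_cat; case: ifP => [/FS//|/negbT].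
    rewrite -leqNgt => Fk; have [] := KS (k - size F)%N => //.
    by rewrite ltn_subLR.
  rewrite ltnS leq_eqVlt => /orP[/eqP aH|/(domF _ Sa)[k [kF ka]]]; last first.
    exists k; split=> [|j js]; first exact: ltn_addr.
    by rewrite nth_cat kF ka.
  have [k [kK ka]] := domK a (conj Sa aH).
  exists (size F + k)%N; split=> [|j]; first by rewrite ltn_add2l.
  rewrite nth_cat ltnNge leq_addr /= addKn inE => /orP[/eqP->|/ka//].
  by rewrite aH; have [_ ->] := KS k kK.
exists (F ++ K); split=> [k|a Sa]; rewrite size_cat.
  move=> kFK; rewrite nth_cat; case: ifP => [/FS//|/negbT].
  by rewrite -leqNgt => Fk; apply: KS; rewrite ltn_subLR.
have [|Ha] := ltnP (a i) H.
  move=> /(domK _ Sa)[k [kK ka]]; exists (size F + k)%N.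
  split=> [|j js]; first by rewrite ltn_add2l.
  by rewrite nth_cat ltnNge leq_addr /= addKn ka.
have [k [kF ka]] := domF a Sa.
exists k; split=> [|j]; first exact: ltn_addr.
rewrite nth_cat kF inE => /orP[/eqP->|/ka//].
by apply: leq_trans Ha; rewrite -[k]/(val (Ordinal kF)) /H; apply: leq_bigmax.
Qed.

(** * Linear equations and positivity on semilinear sets *)

Section Kernel.
Variables (V : nmodType) (f g : V -> nat).
Hypotheses (f0 : f 0 = 0%N) (fD : {morph f : x y / x + y >-> (x + y)%N}).
Hypotheses (g0 : g 0 = 0%N) (gD : {morph g : x y / x + y >-> (x + y)%N}).

(** Dickson's lemma is applied twice to coefficient vectors: minimal solutions give the new bases,
    minimal nonzero homogeneous solutions the new periods. Values in [nat] can be cancelled, so the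
    difference of two comparable solutions is homogeneous. *)
Lemma semilinear_kernel (S : V -> Prop) :
  semilinear S -> semilinear (fun v => S v /\ f v = g v).
Proof.
move: S; apply semilinear_ind.
- move=> S T ST; apply: semilinear_ext => v.
  by split=> -[? ?]; split=> //; apply/ST.
- by apply: semilinear_ext (@semilinear0 _) => v; split=> // -[].
- move=> S T slS slT; apply: semilinear_ext (semilinearU slS slT) => v; split.
    by case=> -[? ?]; split=> //; [left | right].
  by case=> -[?|?] ?; [left | right].
move=> b P; pose comb (a : 'I_(size P) -> nat) := \sum_(i < size P) P`_i *+ a i.
have combD a c : comb (fun i => (a i + c i)%N) = comb a + comb c.
  by rewrite -big_split; apply: eq_bigr => i _; rewrite mulrnDr.
have combP a : nspan P (comb a).
  rewrite /comb; elim/big_rec: _ => [|i v _ Pv]; first by constructor.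
  by apply: nspanD => //; apply: nspanMn; rewrite mem_nth.
have nspanE v : nspan P v -> exists a, v = comb a.
  elim=> [|p w Pp _ [a ->]]; first by exists (fun=> 0%N); rewrite /comb big1.
  have ip : (index p P < size P)%N by rewrite index_mem.
  exists (fun i => ((i == Ordinal ip) + a i)%N); rewrite combD; congr (_ + _).
  rewrite /comb (bigD1 (Ordinal ip)) //= eqxx mulr1n nth_index // big1 ?addr0 //.
  by move=> j /negbTE ->.
have [F [FS domF]] := finite_basis (enum 'I_(size P))
  (fun a => f (b + comb a) = g (b + comb a)).
have [K [KS domK]] := finite_basis (enum 'I_(size P))
  (fun a => f (comb a) = g (comb a) /\ exists i, a i != 0%N).
pose B := [seq b + comb a | a <- F]; pose Q := [seq comb a | a <- K].
apply: semilinear_ext (semilinear_bigU (I := V) (s := B)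
   (fun c _ => semilinear_linear c Q)) => v; split.
  move=> [_ /(nthP 0)[k + <-]]; rewrite size_map => kF.
  rewrite (nth_map (fun=> 0%N)) //= => -[u Qu ->].
  have [Pu fu] : nspan P u /\ f u = g u.
    elim: Qu => [|p w /(nthP 0)[j + <-] _ [Pw fw]].
      by rewrite f0 g0; split=> //; constructor.
    rewrite size_map => jK; rewrite (nth_map (fun=> 0%N)) //.
    split; first exact: nspanD.
    by rewrite fD gD fw; have [->] := KS j jK.
  split; last by rewrite fD gD FS // fu.
  by exists (comb (nth (fun=> 0%N) F k) + u); rewrite ?addrA //; apply: nspanD.
move=> [[_ /= /nspanE[a ->] ->] fg].
have [k [kF ka]] := domF a fg.
exists (b + comb (nth (fun=> 0%N) F k)).
  by rewrite (@map_f _ _ (fun a => b + comb a)) // mem_nth.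
pose c i := (a i - nth (fun=> 0%N) F k i)%N.
have aE : comb a = comb (nth (fun=> 0%N) F k) + comb c.
  by rewrite -combD; apply: eq_bigr => i _; rewrite subnKC // ka ?mem_enum.
exists (comb c); last by rewrite aE addrA.
have {aE} : f (comb c) = g (comb c).
  by move: fg; rewrite aE addrA fD gD FS // => /addnI.
(* Descent on the sum of the coefficients: a nonzero homogeneous solution dominates a minimal one,
   and subtracting it lowers the sum. *)
move: {2}(\sum_i c i)%N (leqnn (\sum_i c i)%N) => m.
move: c => c; elim: m c => [|m IH] c cm fc.
  rewrite /= /comb big1 => [|i _]; first by constructor.
  by move: cm; rewrite (bigD1 i) //= leqn0 addn_eq0 => /andP[/eqP ->].
have [[i ci]|nc] := pselect (exists i, c i != 0%N); last first.
  rewrite /= /comb big1 => [|i _]; first by constructor.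
  by have [->//|ci] := eqVneq (c i) 0%N; case: nc; exists i.
have [j [jK jc]] : exists j, (j < size K)%N /\
    forall l, l \in enum 'I_(size P) -> (nth (fun=> 0%N) K j l <= c l)%N.
  by apply: domK; split=> //; exists i.
have {}jc l : (nth (fun=> 0%N) K j l <= c l)%N by apply: jc; rewrite mem_enum.
have [fj [l jl]] := KS j jK.
pose h := nth (fun=> 0%N) K j; pose c' i := (c i - h i)%N.
have cE : comb c = comb h + comb c'.
  by rewrite -combD; apply: eq_bigr => x _; rewrite subnKC.
rewrite cE; apply: nspanS; first by rewrite map_f // mem_nth.
apply: IH; last by move: fc; rewrite cE fD gD fj => /addnI.
rewrite -ltnS; apply: leq_trans cm; rewrite [X in (_ < X)%N](bigD1 l) //= (bigD1 l) //=.
rewrite -addSn leq_add //.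
  by rewrite /c' ltn_subLR // -[X in (X < _)%N]add0n ltn_add2r lt0n.
by apply: leq_sum => x _; rewrite leq_subr.
Qed.

(** If [f] vanishes at the base, positivity forces the use of some period on which [f] is positive;
    one copy of it is moved into the base. *)
Lemma semilinear_positive (S : V -> Prop) :
  semilinear S -> semilinear (fun v => S v /\ (0 < f v)%N).
Proof.
move: S; apply semilinear_ind.
- move=> S T ST; apply: semilinear_ext => v.
  by split=> -[? ?]; split=> //; apply/ST.
- by apply: semilinear_ext (@semilinear0 _) => v; split=> // -[].
- move=> S T slS slT; apply: semilinear_ext (semilinearU slS slT) => v; split.
    by case=> -[? ?]; split=> //; [left | right].
  by case=> -[?|?] ?; [left | right].
move=> b P; have [fb|fb] := posnP (f b); last first.
  apply: semilinear_ext (semilinear_linear b P) => v; split=> [[u Pu ->]|[]//].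
  by split; [exists u | rewrite fD ltn_addr].
pose B := [seq b + p | p <- P & (0 < f p)%N].
apply: semilinear_ext (semilinear_bigU (I := V) (s := B)
   (fun c _ => semilinear_linear c P)) => v; split.
  move=> [_ /mapP[p + ->] [u Pu ->]]; rewrite mem_filter => /andP[fp Pp].
  split; last by rewrite !fD fb add0n ltn_addr.
  by exists (p + u); [apply: nspanS | rewrite addrA].
move=> [[u /= Pu ->]]; rewrite fD fb add0n.
suff H : nspan P u -> (0 < f u)%N ->
    exists p w, [/\ p \in P, (0 < f p)%N, nspan P w & u = p + w].
  move=> /(H Pu)[p [w [Pp fp Pw ->]]]; exists (b + p).
    by rewrite map_f // mem_filter fp.
  by exists w; rewrite ?addrA.
elim=> [|p w Pp Pw IH]; first by rewrite f0.
rewrite fD; have [fp|fp _] := posnP (f p); last by exists p, w.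
rewrite fp => /IH[q [x [Pq fq Px ->]]]; exists q, (p + x); split=> //.
  exact: nspanS.
by rewrite addrCA.
Qed.

End Kernel.

(** * Parikh's theorem *)

Section Rewriting.
Variables (N : finType) (W : nmodType).

(* A marking records how many open nonterminals of each kind there are,
   and the yield produced so far. *)
Notation marking := ({ffun N -> nat} * W)%type.
Variable rules : seq (N * marking).
Implicit Types (U : seq N) (A B : N) (m v b p q : marking) (n : nat).

Definition open_nt A : marking := ([ffun B => (B == A : nat)], 0).

Inductive rewrites U : nat -> marking -> marking -> Prop :=
| rewrites_refl m : rewrites U 0 m m
| rewrites_step n A b m v : (A, b) \in rules -> A \in U ->
    rewrites U n (m + b) v -> rewrites U n.+1 (m + open_nt A) v.

Lemma rewrites_inv U n m v : rewrites U n m v ->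
  n = 0%N /\ m = v \/
  exists n' A b m', [/\ n = n'.+1, (A, b) \in rules, A \in U,
    m = m' + open_nt A & rewrites U n' (m' + b) v].
Proof.
by case=> [?|k A b m' w Ab AU m'v]; [left | right; exists k, A, b, m'].
Qed.

Definition closed_in U v := forall A, A \in U -> v.1 A = 0%N.

(** Nonterminals outside [U] are treated as terminals, so that Parikh's theorem can be proved by
    adding one nonterminal to [U] at a time. *)
Definition normal_form U m v := (exists n, rewrites U n m v) /\ closed_in U v.

Lemma open_ntE A B : (open_nt A).1 B = (B == A).
Proof. by rewrite ffunE. Qed.

Lemma markD1 m v A : (m + v).1 A = (m.1 A + v.1 A)%N.
Proof. by rewrite /= ffunE. Qed.

Lemma remove_open m A : (0 < m.1 A)%N -> exists k, m = k + open_nt A.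
Proof.
move=> mA; exists ([ffun B => m.1 B - (B == A)]%N, m.2).
case: m mA => f w /= fA; congr pair; rewrite /= ?addr0 //.
apply/ffunP => B; rewrite !ffunE; have [->|_] := eqVneq B A; last by rewrite subn0 addr0.
by rewrite [RHS]subnK.
Qed.

Lemma open_ntI A m k : m + open_nt A = k + open_nt A -> m = k.
Proof.
case: m k => [f w] [g x] [/ffunP fg /=]; rewrite !addr0 => ->; congr pair.
by apply/ffunP => B; move: (fg B); rewrite !ffunE => /addIn.
Qed.

Lemma open_nt_split m k l A : m + k = l + open_nt A ->
  (exists2 m', m = m' + open_nt A & l = m' + k) \/
  (exists2 k', k = k' + open_nt A & l = m + k').
Proof.
move=> e; have: (0 < m.1 A + k.1 A)%N.
  by rewrite -markD1 e markD1 open_ntE eqxx addn1.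
rewrite addn_gt0 => /orP[] /remove_open[x xE]; [left | right]; exists x => //.
  by move: e; rewrite xE addrAC => /open_ntI.
by move: e; rewrite xE addrA => /open_ntI.
Qed.

Lemma rewritesD U n m v k : rewrites U n m v -> rewrites U n (m + k) (v + k).
Proof.
elim=> [{}m|{}n A b {}m {}v Ab AU _ IH]; first by constructor.
by rewrite addrAC; apply: rewrites_step Ab AU _; rewrite addrAC.
Qed.

Lemma rewrites_trans U n n' m v w :
  rewrites U n m v -> rewrites U n' v w -> rewrites U (n + n') m w.
Proof.
move=> mv vw; elim: mv vw => [//|{}n A b {}m {}v Ab AU _ IH] vw.
by rewrite addSn; apply: rewrites_step Ab AU _; apply: IH.
Qed.

Lemma rewrites_sub U U' n m v : {subset U <= U'} ->
  rewrites U n m v -> rewrites U' n m v.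
Proof.
move=> UU'; elim=> [{}m|{}n A b {}m {}v Ab AU _ IH]; first by constructor.
by apply: rewrites_step Ab (UU' _ AU) IH.
Qed.

Lemma rewrites_split U n m k v : rewrites U n (m + k) v ->
  exists n1 n2 v1 v2, [/\ rewrites U n1 m v1, rewrites U n2 k v2,
    v = v1 + v2 & n = (n1 + n2)%N].
Proof.
move mk: (m + k) => l lv; elim: lv m k mk => [{}l|{}n A b {}l {}v Ab AU _ IH] m k mk.
  by exists 0%N, 0%N, m, k; split=> //; constructor.
have [[m' -> e]|[k' -> e]] := open_nt_split mk.
  have [|n1 [n2 [v1 [v2 [r1 r2 -> ->]]]]] := IH (m' + b) k.
    by rewrite e addrAC.
  by exists n1.+1, n2, v1, v2; split=> //; apply: rewrites_step Ab AU r1.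
have [|n1 [n2 [v1 [v2 [r1 r2 -> ->]]]]] := IH m (k' + b).
  by rewrite e addrA.
exists n1, n2.+1, v1, v2; split=> //; last by rewrite addnS.
exact: rewrites_step Ab AU r2.
Qed.

Definition drop_nt B m : marking :=
  ([ffun A => if A == B then 0%N else m.1 A], m.2).

Lemma open_ntMn B j : open_nt B *+ j = ([ffun A => (A == B) * j]%N, 0).
Proof.
elim: j => [|j IH].
  by rewrite mulr0n; congr pair; apply/ffunP => A; rewrite !ffunE muln0.
rewrite mulrS IH; congr pair; rewrite /= ?addr0 //.
by apply/ffunP => A; rewrite !ffunE mulnS.
Qed.

Lemma drop_ntK B m : drop_nt B m + open_nt B *+ m.1 B = m.
Proof.
case: m => f w; rewrite open_ntMn; congr pair; rewrite /= ?addr0 //.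
apply/ffunP => A; rewrite !ffunE; case: eqP => [->|_]; first by rewrite mul1n add0r.
by rewrite mul0n addr0.
Qed.

Lemma drop_ntDMn B v j : v.1 B = 0%N -> drop_nt B (v + open_nt B *+ j) = v.
Proof.
case: v => f w /= fB; rewrite open_ntMn; congr pair; rewrite /= ?addr0 //.
apply/ffunP => A; rewrite !ffunE; case: eqP => [->|_]; first by rewrite fB.
by rewrite mul0n addr0.
Qed.

(** The effect of one firing of a rule for [B] followed by complete rewriting of [U]; new
    occurrences of [B] are left open. *)
Definition pieces U B p := exists2 Ab, Ab \in rules & Ab.1 = B /\ normal_form U Ab.2 p.

Lemma rewrites_fire U B (ps : seq marking) p0 v :
  (forall p, p \in ps -> pieces U B p) ->
  p0 + \sum_(p <- ps) p = v + open_nt B *+ size ps -> v.1 B = 0%N ->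
  (p0.1 B = 0%N -> ps = [::]) ->
  exists n, rewrites (B :: U) n p0 v.
Proof.
move: {2}(size ps) (erefl (size ps)) => k; elim: k ps p0 => [|k IH] ps p0.
  move=> /size0nil -> _; rewrite big_nil !addr0 => -> _ _.
  by exists 0%N; constructor.
move=> szps psP psE vB p0B.
(* A piece that reopens [B] is fired first whenever there is one. If none does, all remaining
   firings draw on the occurrences of [B] in [p0], and the balance equation says that there are
   enough. *)
have [p pps pB] : exists2 p, p \in ps & (k = 0 \/ 0 < (p0.1 B).-1 + p.1 B)%N.
  have [/hasP[p ? ?]|/hasPn np] := boolP (has (fun p => 0 < p.1 B)%N ps).
    by exists p => //; right; rewrite ltn_addl.
  case: ps szps psE np {psP p0B} => // p ps [szps] psE np; exists p; first exact: mem_head.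
  have [k0|k0] := posnP k; [by left | right].
  suff : p0.1 B = k.+1 by move=> ->; rewrite ltn_addr.
  move: (congr1 (fun x : marking => x.1 B) psE); rewrite !markD1 vB.
  have -> : (\sum_(p <- p :: ps) p).1 B = 0%N.
    elim: (p :: ps) np => [|q s IHs] np; first by rewrite big_nil ffunE.
    rewrite big_cons markD1 IHs => [|x xs]; last by apply: np; rewrite inE xs orbT.
    by have := np q (mem_head _ _); rewrite -leqNgt leqn0 addn0 => /eqP.
  by rewrite open_ntMn ffunE eqxx mul1n /= szps addn0.
have /remove_open[l lE] : (0 < p0.1 B)%N.
  by rewrite lt0n; apply/eqP => /p0B ps0; rewrite ps0 in pps.
have [[A b] Ab [/= AB [[n bp] pU]]] := psP p pps.
have szrem : size (rem p ps) = k by rewrite size_rem // szps.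
have [||||n' IHn] := IH (rem p ps) (l + p) szrem.
- by move=> q /mem_rem; apply: psP.
- rewrite szrem; apply: (@open_ntI B); rewrite -[RHS]addrA -mulrSr -szps -psE lE.
  rewrite (perm_big _ (perm_to_rem pps)) big_cons /= -!addrA.
  by rewrite [open_nt B + _]addrCA [open_nt B + _]addrC.
- by [].
- rewrite markD1; move: pB; rewrite lE markD1 open_ntE eqxx addn1 /=.
  case=> [k0 _|]; first by apply: size0nil; rewrite szrem.
  by move=> + e; rewrite e.
exists (n + n').+1; rewrite lE -[in open_nt B]AB; apply: rewrites_step Ab _ _.
  by rewrite AB mem_head.
apply: rewrites_trans IHn; rewrite addrC [l + p]addrC; apply: rewritesD.
by apply: rewrites_sub bp => x; rewrite inE orbC => ->.
Qed.

(** In the commutative setting a family of pieces can be fired in some order as soon as the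
    occurrences of [B] balance their number. The last clause excludes pieces that only supply [B] to
    one another, with no initial occurrence to start them. *)
Lemma normal_form_cons U B m v : B \notin U ->
  normal_form (B :: U) m v <-> exists p0 ps,
    [/\ normal_form U m p0, forall p, p \in ps -> pieces U B p,
        p0 + \sum_(p <- ps) p = v + open_nt B *+ size ps,
        v.1 B = 0%N & p0.1 B = 0%N -> ps = [::]].
Proof.
move=> BU; split=> [[[n mv] vU]|[p0 [ps [[[n mp0] p0U] psP psE vB p0B]]]]; last first.
  have [n' p0v] := rewrites_fire psP psE vB p0B.
  split; first exists (n + n')%N.
    apply: rewrites_trans p0v; apply: rewrites_sub mp0 => x.
    by rewrite inE orbC => ->.
  move=> A; rewrite inE => /orP[/eqP->//|AU].
  move: (congr1 (fun x : marking => x.1 A) psE); rewrite !markD1 p0U //.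
  have -> : (\sum_(p <- ps) p).1 A = 0%N.
    elim: ps psP {p0B psE} => [|q s IHs] psP; first by rewrite big_nil ffunE.
    rewrite big_cons markD1 IHs => [|x xs]; last by apply: psP; rewrite inE xs orbT.
    by have [Ab _ [_ [_ ->]]] := psP q (mem_head _ _).
  by move=> /eqP; rewrite eq_sym addn_eq0 => /andP[/eqP].
have vB : v.1 B = 0%N by apply: vU; rewrite mem_head.
have {}vU : closed_in U v by move=> A AU; apply: vU; rewrite inE AU orbT.
elim: mv vU vB => [{}m|{}n A b {}m {}v Ab + mv IH] vU vB.
  exists m, [::]; split=> //; first by split=> //; exists 0%N; constructor.
  by rewrite big_nil.
have {IH}[p0 [ps [[[n' mp0] p0U] psP psE _ p0B]]] := IH vU vB.
rewrite inE orbC => /orP[AU|/eqP AB].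
  exists p0, ps; split=> //; split=> //.
  by exists n'.+1; apply: rewrites_step Ab AU mp0.
have [n1 [n2 [p1 [p2 [mp1 bp2 p0E _]]]]] := rewrites_split mp0.
have [p1U p2U] : closed_in U p1 /\ closed_in U p2.
  by split=> C /p0U /eqP; rewrite p0E markD1 addn_eq0 => /andP[/eqP ? /eqP].
exists (p1 + open_nt B), (p2 :: ps); split=> //.
- split; first by exists n1; rewrite AB; apply: rewritesD.
  move=> C CU; rewrite markD1 p1U // open_ntE; case: eqP => // CB.
  by rewrite -CB CU in BU.
- move=> p; rewrite inE => /orP[/eqP->|/psP//].
  by exists (A, b) => //; split=> //; split=> //; exists n2.
- rewrite big_cons -[size (p2 :: ps)]/(size ps).+1 mulrS [RHS]addrCA -psE p0E.
  by rewrite [p1 + _]addrC -!addrA.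
- by rewrite markD1 open_ntE eqxx addn1.
Qed.

(** Induction on [U]: for a new nonterminal the pieces form a semilinear set, an arbitrary number of
    them is a star, and the balance in [normal_form_cons] is a linear equation. *)
Lemma semilinear_normal_form U m : semilinear (normal_form U m).
Proof.
elim: U m => [|B U IH] m.
  apply: semilinear_ext (semilinear1 m) => v; split.
    by move=> ->; split=> //; exists 0%N; constructor.
  by case=> -[n mv] _; case: mv => // *; rewrite in_nil in H0.
have [BU|BU] := boolP (B \in U).
  apply: semilinear_ext (IH m) => v; split=> -[[n mv] vU]; split.
  - by exists n; apply: rewrites_sub mv => x; rewrite inE orbC => ->.
  - by move=> A; rewrite inE => /orP[/eqP->|]; apply: vU.
  - exists n; apply: rewrites_sub mv => x.
    by rewrite inE => /orP[/eqP->|].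
  - by move=> A AU; apply: vU; rewrite inE AU orbT.
pose at_B (v : marking) := v.1 B.
have at_B0 : at_B 0 = 0%N by rewrite /at_B ffunE.
have at_BD : {morph at_B : x y / x + y >-> (x + y)%N} by move=> x y; rewrite /at_B markD1.
have slQ : semilinear (pieces U B).
  apply: semilinear_ext (semilinear_bigU (s := [seq Ab <- rules | Ab.1 == B])
     (fun Ab _ => IH Ab.2)) => v; split.
    case=> Ab; rewrite mem_filter => /andP[/eqP AB Abr] ?.
    by exists Ab.
  by move=> [Ab Abr [AB ?]]; exists Ab => //; rewrite mem_filter AB eqxx.
(* The second component counts the pieces used. *)
pose tag j (v : marking) := (v, j) : marking * nat.
have tagD j k x y : tag j x + tag k y = tag (j + k)%N (x + y) by [].
pose Q1 w := exists2 p, pieces U B p & w = tag 1%N p.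
have slQ1 : semilinear Q1.
  have sl1 : semilinear (fun w => w = tag 1%N 0) by apply: semilinear1.
  have /(semilinear_sum sl1) : semilinear (fun w => exists2 p, pieces U B p & w = tag 0%N p).
    by apply: semilinear_image slQ.
  apply: semilinear_ext => w; split.
    by case=> _ [_ [-> [p pP ->] ->]]; exists p => //; rewrite tagD add0r.
  case=> p pP ->; exists (tag 1%N 0), (tag 0%N p); split=> //; first by exists p.
  by rewrite tagD add0r.
have slP : semilinear (fun w => exists2 p, normal_form U m p /\ (0 < at_B p)%N & w = tag 0%N p).
  by apply: semilinear_image => //; apply: semilinear_positive (IH m).
(* Positivity of [at_B] in [slP] encodes the last clause of [normal_form_cons]; an initial part
   without [B] admits no pieces and is handled by [sl0]. *)
have slT := semilinear_kernel (f := fun w => at_B w.1) (g := fun w => w.2)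
  at_B0 (fun x y => at_BD x.1 y.1) (erefl _) (fun x y => erefl _)
  (semilinear_sum slP (semilinear_star slQ1)).
pose drop_B (w : marking * nat) := drop_nt B w.1.
have drop0 : drop_B 0 = 0.
  by congr pair; apply/ffunP => A; rewrite !ffunE; case: eqP.
have dropD : {morph drop_B : x y / x + y}.
  move=> x y; congr pair; apply/ffunP => A.
  by rewrite !ffunE; case: eqP => // _; rewrite addr0.
have sl0 := semilinear_kernel (g := fun=> 0%N) at_B0 at_BD (erefl _)
  (fun x y => erefl _) (IH m).
apply: semilinear_ext (semilinearU sl0 (semilinear_image drop0 dropD slT)) => v.
rewrite normal_form_cons //; split.
  case=> [[mv vB]|[_ [[_ [_ [[p0 [mp0 p0B] ->] [s sQ ->] ->]]] /= sB ->]]].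
    by exists v, [::]; split=> //; rewrite big_nil.
  have [ps psP {sQ}psE] : exists2 ps, forall p, p \in ps -> pieces U B p &
      \sum_(u <- s) u = tag (size ps) (\sum_(p <- ps) p).
    elim: s sQ {sB} => [|u s IHs] sQ; first by exists [::]; rewrite ?big_nil.
    have [|ps psP psE] := IHs _.
      by move=> w ws; apply: sQ; rewrite inE ws orbT.
    have [p pP uE] := sQ u (mem_head _ _).
    exists (p :: ps); last by rewrite !big_cons psE uE tagD.
    by move=> q; rewrite inE => /orP[/eqP->|/psP].
  move: sB; rewrite psE /= => sB.
  exists p0, ps; split=> //.
  - by rewrite -[size ps]sB [LHS](esym (drop_ntK B _)).
  - by rewrite /= ffunE eqxx.
  - by move=> p00; move: p0B; rewrite /at_B p00.
case=> p0 [ps [mp0 psP psE vB p0B]].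
have [p0B0|p0B0] := posnP (at_B p0).
  by left; move: psE; rewrite p0B // big_nil !addr0 => <-.
right; exists (tag (size ps) (p0 + \sum_(p <- ps) p)); first split.
- exists (tag 0%N p0), (tag (size ps) (\sum_(p <- ps) p)); split=> //.
    by exists p0.
  elim: ps psP {psE p0B} => [|p ps IHps] psP.
    by exists [::]; rewrite ?big_nil.
  have [|s sQ sE] := IHps _; first by move=> w ws; apply: psP; rewrite inE ws orbT.
  exists (tag 1%N p :: s); last by rewrite !big_cons -sE tagD.
  move=> w; rewrite inE => /orP[/eqP->|/sQ//].
  by exists p => //; apply: psP; rewrite mem_head.
- rewrite -[LHS]/(at_B (p0 + \sum_(p <- ps) p)) psE /at_B markD1 vB open_ntMn.
  by rewrite ffunE eqxx mul1n.
- by rewrite /drop_B -[_.1]/(p0 + \sum_(p <- ps) p) psE drop_ntDMn.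
Qed.

End Rewriting.

(** * Grammars with binary nodes *)

Section BinaryGrammar.
Variables (N : finType) (W : nmodType) (node : N -> N -> N -> bool) (leaf : N -> seq W).

Inductive generates : N -> W -> Prop :=
| generates_leaf A w : w \in leaf A -> generates A w
| generates_node A B C u w : node A B C ->
    generates B u -> generates C w -> generates A (u + w).

Let rules : seq (N * ({ffun N -> nat} * W)) :=
  [seq (t.1.1, open_nt W t.1.2 + open_nt W t.2)
     | t <- enum {: N * N * N} & node t.1.1 t.1.2 t.2] ++
  [seq (A, (0, w)) | A <- enum N, w <- leaf A].

Let closed_in_all (v : {ffun N -> nat} * W) : closed_in (enum N) v <-> v.1 = 0.
Proof.
split=> [v0|v0 A _]; last by rewrite v0 ffunE.
by apply/ffunP => A; rewrite ffunE v0 ?mem_enum.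
Qed.

(** A tree is linearized into a rewriting sequence; conversely the two children of a node rewrite
    independently by [rewrites_split], and induction runs on the number of steps. *)
Lemma generatesE A w :
  generates A w <-> exists n, rewrites rules (enum N) n (open_nt W A) (0, w).
Proof.
have rule_node B C D : node B C D -> (B, open_nt W C + open_nt W D) \in rules.
  move=> ?; rewrite mem_cat; apply/orP; left; apply/mapP.
  by exists (B, C, D) => //; rewrite mem_filter mem_enum inE andbT.
have rule_leaf B u : u \in leaf B -> (B, (0, u)) \in rules.
  move=> ?; rewrite mem_cat; apply/orP; right; apply/allpairsPdep.
  by exists B, u; split; rewrite ?mem_enum.
have step B b n v : (B, b) \in rules -> rewrites rules (enum N) n b v ->
    rewrites rules (enum N) n.+1 (open_nt W B) v.
  move=> Bb bv; rewrite -[open_nt W B]add0r; apply: rewrites_step Bb _ _.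
    by rewrite mem_enum.
  by rewrite add0r.
split.
  elim=> {A w} [A w /rule_leaf Aw|A B C u w /rule_node ABC _ [n Bu] _ [k Cw]].
    by exists 1%N; apply: step Aw _; constructor.
  exists (n + k).+1; apply: step ABC _.
  have -> : (0, u + w) = (0, u) + (0, w) :> {ffun N -> nat} * W.
    by congr pair; rewrite addr0.
  apply: rewrites_trans (rewritesD _ Bu) _.
  by rewrite addrC [X in rewrites _ _ _ _ X]addrC; apply: rewritesD.
case=> n; elim/ltn_ind: n A w => n IH A w Aw.
have [[_ [/ffunP/(_ A)]]|[n' [B [b [m [nE Bb _ mB mbw]]]]]] := rewrites_inv Aw.
  by rewrite !ffunE eqxx.
have BA : B = A.
  have := congr1 (fun v : {ffun N -> nat} * W => v.1 B) mB.
  by rewrite !markD1 !open_ntE eqxx addn1; case: eqP.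
have m0 : m = 0 by apply: (@open_ntI _ _ A); rewrite add0r -{1}BA -mB.
move: Bb mbw; rewrite BA m0 add0r mem_cat => {BA m0 mB} /orP[].
  case/mapP => -[[A' C] D]; rewrite mem_filter mem_enum andbT /= => ACD [AA' ->].
  rewrite -{A'}AA' in ACD => /rewrites_split[k [l [[f u] [[g x] [Cf Dg [fg ux] kl]]]]].
  have [f0 g0] : f = 0 /\ g = 0.
    split; apply/ffunP => E; move/ffunP/(_ E): fg; rewrite !ffunE => /esym/eqP;
    by rewrite addn_eq0 => /andP[/eqP ? /eqP].
  rewrite ux; apply: generates_node ACD _ _.
    by apply: (IH k); [lia | rewrite -f0].
  by apply: (IH l); [lia | rewrite -g0].
case/allpairsPdep => A' [u [_ Au [-> ->]]] uw.
have [[_ [<-]]|[k [C [c [m' [_ _ _ + _]]]]]] := rewrites_inv uw; first by constructor.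
move/(congr1 (fun v : {ffun N -> nat} * W => v.1 C)).
by rewrite markD1 open_ntE eqxx addn1 ffunE.
Qed.

Theorem semilinear_generates A : semilinear (generates A).
Proof.
have fstD : {morph (@snd {ffun N -> nat} W) : x y / x + y} by [].
have := semilinear_image (erefl _) fstD
  (semilinear_normal_form rules (enum N) (open_nt W A)).
apply: semilinear_ext => w; rewrite generatesE; split.
  case=> -[f u] [[n Af] /closed_in_all /= f0] ->; exists n.
  by rewrite -f0.
case=> n Aw; exists (0, w) => //; split; first by exists n.
exact/closed_in_all.
Qed.

End BinaryGrammar.

(** * Lower envelopes of semilinear sets *)

Section EventuallyArithmetic.
Local Open Scope nat_scope.

Lemma enat_inf_Some (A : set nat) l :
  A l -> (forall l', A l' -> l <= l') -> enat_inf A = Some l.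
Proof.
move=> Al lA; rewrite /enat_inf; case: pselect => [exA|nA]; last first.
  by case: nA; exists l; apply/asboolP.
congr Some; case: ex_minnP => n /asboolP An minn; apply/eqP; rewrite eqn_leq.
by rewrite lA // minn //; apply/asboolP.
Qed.

Lemma enat_infP (A : set nat) :
  (exists l, [/\ enat_inf A = Some l, A l & forall l', A l' -> l <= l']) \/
  (enat_inf A = None /\ forall l, ~ A l).
Proof.
have [[l Al]|nA] := pselect (exists l, A l).
  have exA : exists l, `[< A l >] by exists l; apply/asboolP.
  have mA l' : A l' -> ex_minn exA <= l'.
    by case: ex_minnP => n _ minn Al'; apply: minn; apply/asboolP.
  left; exists (ex_minn exA); split=> //.
  - by apply: enat_inf_Some => //; case: ex_minnP => n /asboolP.
  - by case: ex_minnP => n /asboolP.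
right; split; last by move=> l Al; apply: nA; exists l.
rewrite /enat_inf; case: pselect => // exA; case: nA.
by case: exA => l /asboolP Al; exists l.
Qed.

Definition enat_min (a b : enat) : enat :=
  match a, b with
  | Some x, Some y => Some (minn x y)
  | Some x, None => Some x
  | None, _ => b
  end.

Lemma enat_infU (A B : set nat) : enat_inf (A `|` B) = enat_min (enat_inf A) (enat_inf B).
Proof.
have [[x [-> Ax minx]]|[-> nA]] := enat_infP A;
have [[y [-> By miny]]|[-> nB]] := enat_infP B => /=.
- apply: enat_inf_Some => [|l [/minx|/miny]]; last 2 first.
  + by apply: leq_trans; rewrite geq_minl.
  + by apply: leq_trans; rewrite geq_minr.
  by rewrite minnE; case: (leqP x y) => xy; [left | right];
    [rewrite (eqP xy) subn0 | rewrite subKn // ltnW].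
- by apply: enat_inf_Some => [|l [/minx|/nB]] //; left.
- by apply: enat_inf_Some => [|l [/nA|/miny]] //; right.
- by have [[l [_ [/nA|/nB]]]|[]] := enat_infP (A `|` B).
Qed.

Lemma enat_addA a d e : enat_add (enat_add a d) e = enat_add a (d + e).
Proof. by case: a => //= x; rewrite addnA. Qed.

Lemma enat_add0 a : enat_add a 0 = a.
Proof. by case: a => //= x; rewrite addn0. Qed.

Lemma arithmeticE d a : Defs.arithmetic d a <-> forall k, a k = enat_add (a 0) (d * k).
Proof.
split=> [ad|ad k]; last by rewrite ad (ad k) enat_addA mulnSr.
by elim=> [|k IH]; rewrite ?muln0 ?enat_add0 // ad IH enat_addA mulnSr.
Qed.

Lemma eventually_arithmeticE d a : eventually_arithmetic d a <->
  exists N c, forall k, N <= k -> a k = enat_add c (d * (k - N)).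
Proof.
split=> [[N /arithmeticE aN]|[N [c aN]]].
  by exists N, (a N) => k Nk; rewrite -{1}(subnK Nk) aN add0n.
exists N; apply/arithmeticE => k.
by rewrite !aN ?leq_addl // addnK subnn muln0 enat_add0.
Qed.

Lemma eventually_arithmetic_from d a N : eventually_arithmetic d a ->
  exists M c, N <= M /\ forall k, M <= k -> a k = enat_add c (d * (k - M)).
Proof.
move=> /eventually_arithmeticE[M [c aM]].
exists (maxn N M), (enat_add c (d * (maxn N M - M))); split=> [|k].
  exact: leq_maxl.
rewrite geq_max => /andP[Nk Mk]; rewrite aM // enat_addA -mulnDr; congr (enat_add c (d * _)).
by lia.
Qed.

Lemma eventually_arithmetic_eq d a b N : (forall k, N <= k -> a k = b k) ->
  eventually_arithmetic d a -> eventually_arithmetic d b.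
Proof.
move=> ab /(eventually_arithmetic_from N)[M [c [NM aM]]].
apply/eventually_arithmeticE; exists M, c => k Mk.
by rewrite -ab ?aM //; apply: leq_trans Mk.
Qed.

Lemma eventually_arithmetic_min d e a b :
  eventually_arithmetic d a -> eventually_arithmetic e b ->
  exists f, eventually_arithmetic f (fun k => enat_min (a k) (b k)).
Proof.
wlog de : a b d e / d <= e => [ih|].
  have [|/ltnW] := leqP d e; first exact: ih.
  move=> ed ad be; have [f abf] := ih _ _ _ _ ed be ad; exists f.
  apply: (eventually_arithmetic_eq (N := 0)) abf => k _.
  by case: (a k) (b k) => [x|] [y|] //=; rewrite minnC.
move=> ad be; have [M [c [_ aM]]] := eventually_arithmetic_from 0 ad.
have [K [c' [MK bK]]] := eventually_arithmetic_from M be.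
have {}aM k : K <= k -> a k = enat_add (enat_add c (d * (K - M))) (d * (k - K)).
  move=> Kk; rewrite aM ?(leq_trans MK) // enat_addA -mulnDr; congr (enat_add c (d * _)).
  by lia.
move: (enat_add c _) aM => {}c aM.
case: c aM => [x|] aM; last first.
  by exists e; apply: (eventually_arithmetic_eq (N := K)) be => k Kk; rewrite aM.
case: c' bK => [y|] bK; last first.
  by exists d; apply: (eventually_arithmetic_eq (N := K)) ad => k Kk; rewrite aM // bK.
exists d; move: de; rewrite leq_eqVlt => /orP[/eqP de|de].
  apply/eventually_arithmeticE; exists K, (Some (minn x y)) => k Kk.
  by rewrite aM // bK // de /= addn_minl.
(* The slopes differ by at least 1, so [x] steps past [K] the steeper progression is no longer below
   the other, even if it starts at 0. *)
apply: (eventually_arithmetic_eq (N := K + x)) ad => k Kk.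
rewrite aM ?bK; [|lia|lia]; rewrite /=; congr Some.
by apply/esym/minn_idPl; nia.
Qed.

Lemma eventually_arithmetic_sub d a q r : 0 < q -> eventually_arithmetic d a ->
  eventually_arithmetic (d * q) (fun k => a (q * k + r)).
Proof.
move=> q0 /eventually_arithmeticE[M [c aM]]; apply/eventually_arithmeticE.
exists M, (enat_add c (d * (q * M + r - M))) => k Mk.
have Mq j : M <= j -> M <= q * j + r.
  by move=> Mj; rewrite (leq_trans Mj) // (leq_trans (leq_pmull j q0)) ?leq_addr.
rewrite aM ?Mq // enat_addA; congr (enat_add c _).
rewrite -mulnA -mulnDr; congr (d * _).
have := Mq M (leqnn M); rewrite mulnBr; have := leq_mul (leqnn q) Mk; lia.
Qed.

(* The difference may depend on the residue class here. *)
Definition semi_arithmetic (a : nat -> enat) :=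
  exists2 m, 0 < m & forall r, exists d, eventually_arithmetic d (fun k => a (m * k + r)).

Lemma semi_arithmetic_eq a b N : (forall k, N <= k -> a k = b k) ->
  semi_arithmetic a -> semi_arithmetic b.
Proof.
move=> ab [m m0 am]; exists m => // r; have [d ad] := am r; exists d.
apply: (eventually_arithmetic_eq (N := N)) ad => k Nk; apply: ab.
by rewrite (leq_trans Nk) // (leq_trans (leq_pmull k m0)) ?leq_addr.
Qed.

Lemma semi_arithmetic_min a b : semi_arithmetic a -> semi_arithmetic b ->
  semi_arithmetic (fun k => enat_min (a k) (b k)).
Proof.
move=> [m m0 am] [n n0 bn]; exists (m * n); first by rewrite muln_gt0 m0.
move=> r; have [d ad] := am r; have [e be] := bn r.
have {}ad := eventually_arithmetic_sub 0 n0 ad.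
have {}be := eventually_arithmetic_sub 0 m0 be.
have [f abf] := eventually_arithmetic_min ad be; exists f.
apply: (eventually_arithmetic_eq (N := 0)) abf => k _.
by rewrite !addn0 !mulnA [n * m]mulnC.
Qed.

Lemma semi_arithmetic_shift a m d N : 0 < m ->
  (forall k, N <= k -> a (k + m) = enat_add (a k) d) -> semi_arithmetic a.
Proof.
move=> m0 am; exists m => // r; exists d, N => k /=.
rewrite addSn mulnS -addnA addnC am // (leq_trans _ (leq_addr r _)) //.
by rewrite (leq_trans (leq_addl k N)) // leq_pmull.
Qed.

(** Slopes are compared by cross-multiplication; vertical periods satisfy the inequality
    trivially. *)
Lemma least_slope (P : seq (nat * nat)) : has (fun p => 0 < p.1) P ->
  exists p, [/\ p \in P, 0 < p.1 & forall q, q \in P -> p.2 * q.1 <= q.2 * p.1].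
Proof.
elim: P => // p P IH /=; have [/IH{IH}[s [sP s0 sm]] _|nP] := boolP (has _ P).
  have [ps|ps] := leqP (s.2 * p.1) (p.2 * s.1).
    exists s; split=> // [|q]; first by rewrite inE sP orbT.
    by rewrite inE => /orP[/eqP->|/sm].
  have p0 : 0 < p.1 by nia.
  exists p; split=> // [|q]; first exact: mem_head.
  rewrite inE => /orP[/eqP->//|/sm sq].
  rewrite -(leq_pmul2r s0) mulnAC.
  rewrite (leq_trans (leq_mul (ltnW ps) (leqnn q.1))) // mulnAC.
  by rewrite [leqRHS]mulnAC leq_mul2r sq orbT.
rewrite orbF => p0; exists p; split=> // [|q]; first exact: mem_head.
rewrite inE => /orP[/eqP->//|qP].
by have /hasPn/(_ q qP) := nP; rewrite -eqn0Ngt => /eqP ->; rewrite muln0.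
Qed.

Lemma nspan_cons (V : nmodType) (p : V) P v : nspan (p :: P) v ->
  exists n w, nspan P w /\ v = (p *+ n + w)%R.
Proof.
rewrite -cat1s => /nspan_cat[u [w [pu Pw ->]]].
suff [n ->] : exists n, u = (p *+ n)%R by exists n, w.
elim: pu => [|q x]; first by exists 0; rewrite mulr0n.
by rewrite inE => /eqP -> _ [n ->]; exists n.+1; rewrite mulrS.
Qed.

(* Trading [p.1] copies of [q] for [q.1] copies of [p] does not increase the
   second coordinate when the slope of [p] is at most that of [q]. *)
Lemma nspan_exchange p (P : seq (nat * nat)) v : 0 < p.1 ->
  (forall q, q \in P -> p.2 * q.1 <= q.2 * p.1) -> nspan P v ->
  exists c w, [/\ nspan P w, w.1 <= p.1 * \sum_(q <- P) q.1,
    v.1 = c * p.1 + w.1 :> nat & c * p.2 + w.2 <= v.2].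
Proof.
move=> p0; elim: P v => [|q P IH] v pP.
  case=> [|q w]; last by rewrite in_nil.
  by exists 0, (0 : nat * nat)%R; split=> //; constructor.
move=> /nspan_cons[n [u [Pu ->]]].
have [x xP|c [w [Pw wP uE uw]]] := IH u _ Pu.
  by apply: pP; rewrite inE xP orbT.
have qE k : (q *+ k)%R = (k * q.1, k * q.2).
  elim: k => [|k IHk]; first by rewrite mulr0n.
  by rewrite mulrS IHk [LHS](_ : _ = (q.1 + k * q.1, q.2 + k * q.2)) // !mulSn.
exists ((n %/ p.1) * q.1 + c), (q *+ (n %% p.1) + w)%R; split.
- apply: nspanD; first by apply: nspanMn; rewrite mem_head.
  by apply: nspan_sub Pw => x xP; rewrite inE xP orbT.
- rewrite big_cons mulnDr qE; apply: leq_add => //=.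
  by rewrite leq_mul2r ltnW ?orbT // ltn_mod.
- rewrite !qE -[LHS]/(n * q.1 + u.1) -[(_ + w)%R.1]/(n %% p.1 * q.1 + w.1) uE.
  by rewrite {1}(divn_eq n p.1); nia.
- rewrite !qE -[leqRHS]/(n * q.2 + u.2) -[(_ + w)%R.2]/(n %% p.1 * q.2 + w.2).
  have := pP q (mem_head _ _) => pq.
  have : n %/ p.1 * q.1 * p.2 <= n %/ p.1 * p.1 * q.2.
    by rewrite -!mulnA leq_mul2l mulnC [p.1 * _]mulnC pq orbT.
  have -> : n * q.2 = n %/ p.1 * p.1 * q.2 + n %% p.1 * q.2.
    by rewrite -mulnDl -divn_eq.
  by rewrite !mulnDl; move: (n %/ _) (n %% _) => k r; lia.
Qed.

Definition lower_envelope (S : nat * nat -> Prop) k : enat :=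
  enat_inf [set l | S (k, l)].

(** A period [p] of least slope governs the envelope. Beyond the threshold, [nspan_exchange] turns
    every element into one that uses [p] at least once and is no higher, so minimal points can be
    shifted by [p] in both directions. With no period of positive first coordinate the fibres are
    eventually empty. *)
Lemma lower_envelope_linear b P : semi_arithmetic (lower_envelope (linear_set (b, P))).
Proof.
have [/least_slope[p [pP p0 pm]]|/hasPn nP] := boolP (has (fun p => 0 < p.1) P).
  apply: (@semi_arithmetic_shift _ p.1 p.2
    (b.1 + p.1 * \sum_(q <- P) q.1)) => // k bk.
  have up l : linear_set (b, P) (k, l) -> linear_set (b, P) (k + p.1, l + p.2).
    case=> u /= Pu uE; exists (p + u)%R; first exact: nspanS.
    by rewrite addrCA -uE /= -[RHS]/(p.1 + k, p.2 + l) addnC [p.2 + _]addnC.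
  have down l : linear_set (b, P) (k + p.1, l) ->
      exists2 l', linear_set (b, P) (k, l') & l' + p.2 <= l.
    case=> u /= /(nspan_exchange p0 pm)[c [w [Pw wP uE uw]]] klE.
    have kE : k + p.1 = b.1 + u.1 :> nat := congr1 fst klE.
    have lE : l = b.2 + u.2 :> nat := congr1 snd klE.
    case: c uE uw => [|c] uE uw.
      (* With no copy of [p], the first coordinate [k + p.1] would be at most the threshold, hence
         at most [k], against [p0]. *)
      exfalso; move: kE bk wP; rewrite uE mul0n add0n.
      by move: (p.1 * _)%N w.1 => T w1; lia.
    rewrite mulSn in uw; rewrite mulSn in uE.
    exists (b.2 + (c * p.2 + w.2)); last first.
      by rewrite lE -addnA leq_add2l addnC addnA.
    exists (p *+ c + w)%R; first by apply: nspanD => //; apply: nspanMn.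
    have pE j : (p *+ j)%R = (j * p.1, j * p.2).
      elim: j => [|j IHj]; first by rewrite mulr0n.
      by rewrite mulrS IHj [LHS](_ : _ = (p.1 + j * p.1, p.2 + j * p.2)) // !mulSn.
    rewrite pE -[RHS]/(b.1 + (c * p.1 + w.1), b.2 + (c * p.2 + w.2)).
    congr pair; apply: (@addIn p.1); rewrite kE uE -[RHS]addnA.
    by rewrite [X in _ = b.1 + X]addnC [X in _ = b.1 + X]addnA.
  rewrite /lower_envelope.
  have [[j [-> jS lmin]]|[-> nS]] := enat_infP [set l | linear_set (b, P) (k, l)].
    apply: enat_inf_Some => [|l' /down[l'' /lmin]]; first exact: up.
    by move=> ll'' /(leq_trans _); apply; rewrite leq_add2r.
  have [[l [_ /down[l' /nS//]]]|[-> _//]] :=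
    enat_infP [set l | linear_set (b, P) (k + p.1, l)].
have empty k : b.1 < k -> lower_envelope (linear_set (b, P)) k = None.
  move=> bk; rewrite /lower_envelope.
  have [[l [_ [u /= Pu uE] _]]|[]//] := enat_infP [set l | linear_set (b, P) (k, l)].
  have u1 : u.1 = 0.
    elim: Pu {uE} => [|p w /nP p1 _ wE] //.
    by rewrite -[LHS]/(p.1 + w.1) wE addn0; apply/eqP; rewrite eqn0Ngt.
  have kE : k = b.1 + u.1 :> nat := congr1 fst uE.
  by rewrite kE u1 addn0 ltnn in bk.
by apply: (@semi_arithmetic_shift _ 1 0 b.1.+1) => // k bk; rewrite !empty ?addn1 // ltnW.
Qed.

Lemma semi_arithmetic_envelope S : semilinear S -> semi_arithmetic (lower_envelope S).
Proof.
move: S; apply semilinear_ind.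
- move=> S T ST; apply: (semi_arithmetic_eq (N := 0)) => k _.
  by congr enat_inf; apply/seteqP; split=> l /=; rewrite ST.
- apply: (@semi_arithmetic_shift _ 1 0 0) => // k _; rewrite enat_add0.
  by congr enat_inf.
- move=> S T aS aT; apply: (semi_arithmetic_eq (N := 0)) (semi_arithmetic_min aS aT) => k _.
  by rewrite -enat_infU.
- exact: lower_envelope_linear.
Qed.

(* The sequence cannot increase faster along one residue class than along the
   previous one, and the classes are visited cyclically. *)
Lemma semi_arithmetic_uniform (f : nat -> nat) C :
  (forall k, f k.+1 <= f k + C) -> semi_arithmetic (fun k => Some (f k)) ->
  uniformly_semi_arithmetic (fun k => Some (f k)).
Proof.
move=> fC [m m0 fm].
have slope r d : eventually_arithmetic d (fun k => Some (f (m * k + r))) ->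
    exists N x, forall k, N <= k -> f (m * k + r) + d * N = x + d * k.
  move=> /eventually_arithmeticE[N [[x|] fN]]; last by have := fN N (leqnn N).
  exists N, x => k Nk; have [->] := fN k Nk.
  by rewrite -addnA -mulnDr subnK.
have step r d e : eventually_arithmetic d (fun k => Some (f (m * k + r))) ->
    eventually_arithmetic e (fun k => Some (f (m * k + r.+1))) -> e <= d.
  move=> /slope[N [x fN]] /slope[M [y fM]]; rewrite leqNgt; apply/negP => de.
  (* Large enough for a slope gap of at least 1 to outweigh the offsets and the step bound [C]. *)
  pose k := N + M + x + C + e * M + 1.
  have := fN k; have := fM k; have := fC (m * k + r); rewrite -addnS.
  have : N <= k by lia.
  have : M <= k by lia.
  have : d.+1 * k <= e * k by rewrite leq_mul2r de orbT.
  rewrite mulSn; lia.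
have chain r s d e : eventually_arithmetic d (fun k => Some (f (m * k + r))) ->
    eventually_arithmetic e (fun k => Some (f (m * k + (r + s)))) -> e <= d.
  elim: s e => [|s IH] e rd.
    rewrite addn0 => /slope[N [x fN]]; have [M [y fM]] := slope _ _ rd.
    rewrite leqNgt; apply/negP => de; pose k := N + M + y + e * N + 1.
    have := fN k; have := fM k.
    have : N <= k by lia.
    have : M <= k by lia.
    have : d.+1 * k <= e * k by rewrite leq_mul2r de orbT.
    rewrite mulSn; lia.
  rewrite addnS; have [e' se'] := fm (r + s) => /(step _ _ _ se').
  by move/leq_trans; apply; apply: IH.
have [d fd] := fm 0; exists m, d; split=> // r.
have [e fe] := fm r; suff -> : d = e by [].
apply/eqP; rewrite eqn_leq (chain 0 r _ _ fd) // andbT.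
(* The class of [m * r] is that of 0 read from index [r] on, so its difference is [d]; reaching it
   from [r] closes the cycle. *)
have shift : eventually_arithmetic d (fun k => Some (f (m * k + (r + (m * r - r))))).
  rewrite subnKC; last exact: leq_pmull.
  have := eventually_arithmetic_sub r (isT : 0 < 1) fd; rewrite muln1.
  apply: (eventually_arithmetic_eq (N := 0)) => k _.
  by rewrite mul1n addn0 mulnDr.
exact: chain shift.
Qed.

End EventuallyArithmetic.

(** * The limit of the ratio *)

Lemma uniformly_semi_arithmetic_linear (f : nat -> nat) m d :
  uniformly_semi_arithmetic_with m d (fun k => Some (f k)) ->
  exists C K, forall k, (K <= k)%N ->
    (m * f k <= d * k + C)%N /\ (d * k <= m * f k + C)%N.
Proof.
move=> [m0 fm].
suff /(_ m (leqnn m))[C [K CK]] : forall s, (s <= m)%N ->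
    exists C K, forall k, (K <= k)%N ->
    (k %% m < s)%N -> (m * f k <= d * k + C)%N /\ (d * k <= m * f k + C)%N.
  by exists C, K => k Kk; apply: CK => //; rewrite ltn_mod.
elim=> [|s IH] sm; first by exists 0%N, 0%N.
have [C [K CK]] := IH (ltnW sm).
have /eventually_arithmeticE[N [[x|] fN]] := fm s; last by have := fN N (leqnn N).
(* On the residue [s], the gap between [m * f k] and [d * k] comes from [m * x], [d * m * N] and
   [d * s] with [s < m]; adding [C] keeps the bound for earlier residues. *)
exists (C + m * x + d * m * N + d * m)%N, (K + m * N + m)%N => k Kk.
have Kk' : (K <= k)%N by lia.
rewrite ltnS leq_eqVlt => /orP[/eqP ks|ks]; last by have := CK _ Kk' ks; lia.
have kE : k = (m * (k %/ m) + s)%N by rewrite -ks mulnC -divn_eq.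
have Nk : (N <= k %/ m)%N by rewrite leq_divRL // mulnC; lia.
have := fN _ Nk; rewrite -kE => -[->].
move: kE Nk; move: (k %/ m)%N => q kE Nq.
have -> : (d * k = d * m * q + d * s)%N by rewrite kE mulnDr mulnA.
have -> : (m * (x + d * (q - N)) = m * x + (d * m * q - d * m * N))%N.
  by rewrite mulnDr mulnBr mulnBr [(d * m)%N]mulnC !mulnA.
have := leq_mul (leqnn (d * m)) Nq; have := leq_mul (leqnn d) (ltnW sm).
lia.
Qed.

Lemma linear_ratio_cvg (R : realType) (f : nat -> nat) m d C K : (0 < m)%N ->
  (forall k, (K <= k)%N ->
    (m * f k <= d * k + C)%N /\ (d * k <= m * f k + C)%N) ->
  (f k)%:R / k%:R @[k --> \oo] --> (d%:R / m%:R : R).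
Proof.
move=> m0 fC; apply/cvgrPdist_le => e e0; near=> k.
have [f_le f_ge] : (m * f k <= d * k + C)%N /\ (d * k <= m * f k + C)%N.
  by apply: fC; near: k; exact: nbhs_infty_ge.
have k0 : 0 < k%:R :> R by rewrite ltr0n; near: k; exact: nbhs_infty_gt.
have mR0 : 0 < m%:R :> R by rewrite ltr0n.
have -> : d%:R / m%:R - (f k)%:R / k%:R =
    (d%:R * k%:R - m%:R * (f k)%:R) / (m%:R * k%:R) :> R.
  by field; rewrite !gt_eqF.
rewrite normrM normfV [`|m%:R * k%:R|]ger0_norm ?mulr_ge0 ?ler0n //.
rewrite ler_pdivrMr ?mulr_gt0 // (@le_trans _ _ C%:R) //.
  by rewrite ler_distl lerBlDr -!natrM -!natrD !ler_nat f_le f_ge.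
have : C%:R / e <= k%:R by near: k; exact: nbhs_infty_ger.
rewrite ler_pdivrMr // [k%:R * e]mulrC => /le_trans; apply.
by apply: ler_wpM2l; [exact: ltW | rewrite ler_peMl ?ler0n ?ler1n].
Unshelve. all: by end_near.
Qed.

Lemma power_norm_limit (R : realType) (G : groupType) (S : set G) n (g : 'I_n -> G)
    (f : nat -> nat) m d :
  (forall k, power_norm S g k = Some (f k)) ->
  uniformly_semi_arithmetic_with m d (power_norm S g) ->
  cvg (power_norm_ratio R S g @ \oo) /\ tau R S g = (d%:R / m%:R)%:E.
Proof.
move=> gf gmd; have fmd : uniformly_semi_arithmetic_with m d (fun k => Some (f k)).
  rewrite (_ : (fun k => Some (f k)) = power_norm S g) //.
  by apply/funext => k; rewrite gf.
have [m0 _] := fmd; have [C [K CK]] := uniformly_semi_arithmetic_linear fmd.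
have gE : power_norm_ratio R S g = fun k => ((f k)%:R / k%:R)%:E.
  by apply/funext => k; rewrite /power_norm_ratio gf EFinM.
have lim : power_norm_ratio R S g @ \oo --> (d%:R / m%:R)%:E.
  by rewrite gE; apply: cvg_EFin; [near=> k | exact: linear_ratio_cvg CK].
by split; [apply/cvg_ex; eexists; exact: lim | exact: cvg_lim].
Unshelve. all: by end_near.
Qed.

(** * The norm as a deletion distance *)

Section Deletion.
Variable T : Type.
Implicit Types s t : seq T.

Inductive deletion : seq T -> seq T -> nat -> Prop :=
| deletion_nil : deletion [::] [::] 0
| deletion_keep a s t l : deletion s t l -> deletion (a :: s) (a :: t) l
| deletion_drop a s t l : deletion s t l -> deletion (a :: s) t l.+1.

Lemma deletion_refl s : deletion s s 0.
Proof. by elim: s => [|a s IH]; constructor. Qed.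

Lemma deletion_cat s1 s2 t1 t2 l1 l2 : deletion s1 t1 l1 -> deletion s2 t2 l2 ->
  deletion (s1 ++ s2) (t1 ++ t2) (l1 + l2).
Proof. by move=> d1 d2; elim: d1 => //= *; constructor. Qed.

Lemma deletion_consP a s t l : deletion (a :: s) t l ->
  (exists2 t', t = a :: t' & deletion s t' l) \/
  (exists2 l', l = l'.+1 & deletion s t l').
Proof.
move sE: (a :: s) => s' d; case: d sE => // b s1 t1 l1 d [-> ->].
  by left; exists t1.
by right; exists l1.
Qed.

Lemma deletion_catP s1 s2 t l : deletion (s1 ++ s2) t l ->
  exists t1 t2 l1 l2, [/\ deletion s1 t1 l1, deletion s2 t2 l2,
    t = t1 ++ t2 & l = (l1 + l2)%N].
Proof.
elim: s1 t l => [|a s1 IH] t l /=.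
  by move=> d; exists [::], t, 0%N, l; split=> //; constructor.
case/deletion_consP=> [[t' -> /IH]|[l' -> /IH]] [t1 [t2 [l1 [l2 [d1 d2 -> ->]]]]].
  by exists (a :: t1), t2, l1, l2; split=> //; constructor.
by exists t1, t2, l1.+1, l2; split=> //; constructor.
Qed.

Lemma deletion_nilP t l : deletion [::] t l -> t = [::] /\ l = 0%N.
Proof. by move sE: [::] => s d; case: d sE. Qed.

Lemma deletion0 s t : deletion s t 0 -> t = s.
Proof.
move l0: 0%N => l d; elim: d l0 => // a {}s {}t {}l _ IH /IH -> //.
Qed.

Lemma deletion_trans s t u l k :
  deletion s t l -> deletion t u k -> deletion s u (l + k).
Proof.
move=> d; elim: d u k => [|a s1 t1 l1 _ IH|a s1 t1 l1 _ IH] u k //.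
  case/deletion_consP => [[u' -> d]|[k' -> d]].
    by constructor; apply: IH.
  by rewrite addnS; constructor; apply: IH.
by move=> d; rewrite addSn; constructor; apply: IH.
Qed.

Lemma deletion_size s t l : deletion s t l -> (size t + l)%N = size s.
Proof. by elim=> //= *; lia. Qed.

Lemma deletion_prefix s ts : deletion (s ++ ts) ts (size s).
Proof. by elim: s => [|a s IH] /=; [apply: deletion_refl | constructor]. Qed.

End Deletion.

Section ConjugateProducts.
Variables (G : groupType) (S : set G).
Local Open Scope group_scope.

Inductive conj_product : nat -> G -> Prop :=
| conj_product0 : conj_product 0 1
| conj_productS l h s g : S s -> conj_product l g ->
    conj_product l.+1 (h * s * h^-1 * g).

Lemma conj_productE l g : conj_product l g <->
  exists h s : 'I_l -> G, (forall i, S (s i)) /\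
    \prod_(i < l) (h i * s i * (h i)^-1) = g.
Proof.
split.
  elim=> [|{}l h0 s0 {}g Ss0 _ [h [s [Ss <-]]]].
    by exists (fun=> 1), (fun=> 1); rewrite big_ord0; split=> // -[].
  exists (fun i => if unlift ord0 i is Some j then h j else h0),
    (fun i => if unlift ord0 i is Some j then s j else s0); split.
    by move=> i; case: unliftP.
  rewrite big_ord_recl unlift_none; congr (_ * _); apply: eq_bigr => i _.
  by rewrite liftK.
elim: l g => [|l IH] g [h [s [Ss <-]]]; first by rewrite big_ord0; constructor.
rewrite big_ord_recl; constructor => //; apply: IH.
by exists (fun i => h (lift ord0 i)), (fun i => s (lift ord0 i)).
Qed.

Lemma conj_normE g : conj_norm S g = enat_inf [set l | conj_product l g].
Proof. by congr enat_inf; apply/seteqP; split=> l /conj_productE. Qed.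

End ConjugateProducts.

(** * Signed letter counts and the exchange property *)

Section Words.
Variables (G : groupType) (X : Type) (f : X -> G).
Local Open Scope group_scope.
Implicit Types (u v w : word X) (g t : G).
Local Notation val := (word_val f).
Local Notation lval := (letter_val f).

Lemma word_val_nil : val [::] = 1.
Proof. exact: big_nil. Qed.

Lemma word_val_cons a w : val (a :: w) = lval a * val w.
Proof. exact: big_cons. Qed.

Lemma word_val_cat u v : val (u ++ v) = val u * val v.
Proof. exact: big_cat. Qed.

Definition inv_letter (a : X * bool) := (a.1, ~~ a.2).
Definition inv_word w := rev (map inv_letter w).

Lemma letter_valV a : lval (inv_letter a) = (lval a)^-1.
Proof. by case: a => x [] //=; rewrite /letter_val /= invgK. Qed.

Lemma word_valV w : val (inv_word w) = (val w)^-1.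
Proof.
elim: w => [|a w IH]; first by rewrite word_val_nil invg1.
rewrite /inv_word /= rev_cons -cats1 word_val_cat IH !word_val_cons word_val_nil.
by rewrite mulg1 letter_valV invgM.
Qed.

(** A letter [a] standing after [c] is removed by splitting off its conjugate: c a s = (c a c^-1) c
    s. The prefix [c] is general because the letters kept accumulate in it. *)
Lemma deletion_conj_product w w' l k c : deletion w w' l ->
  conj_product (pm_set f) k (c * val w') -> conj_product (pm_set f) (l + k) (c * val w).
Proof.
move=> d; elim: d c => [//|a s t {}l _ IH c|a s t {}l _ IH c].
  by rewrite !word_val_cons !mulgA; apply: IH.
move=> /IH ck; rewrite word_val_cons addSn.
have -> : c * (lval a * val s) = c * lval a * c^-1 * (c * val s).
  by rewrite !mulgA mulgVK.
by constructor=> //; case: a => x []; exists x; [left | right].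
Qed.

(* Each letter [x^e] preceded by [p] contributes [e] at the conjugate
   [p x p^-1]; modulo 2 this is the reflection cocycle of a Coxeter group. *)
Fixpoint conj_count t w : int :=
  if w is (x, e) :: w' then
    (if f x == t then (if e then 1 else -1) else 0)%R +
      conj_count (t ^ lval (x, e)) w'
  else 0%R.

Lemma conj_count_cat t u v :
  conj_count t (u ++ v) = (conj_count t u + conj_count (t ^ val u) v)%R.
Proof.
elim: u t => [|[x e] u IH] t /=; first by rewrite word_val_nil conjg1 add0r.
by rewrite IH word_val_cons conjgM addrA.
Qed.

Lemma conj_letter x e t : (f x == t ^ lval (x, e)) = (f x == t).
Proof.
have fxe : f x ^ lval (x, e) = f x.
  by case: e; rewrite /letter_val conjgE /= ?mulKg // invgK mulgV mulg1.
by rewrite -{1}fxe; apply/eqP/eqP => [/conjg_inj|->].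
Qed.

Lemma conj_count_cancel t x e : conj_count t [:: (x, e); (x, ~~ e)] = 0%R.
Proof. by rewrite /= conj_letter; case: eqP; case: e. Qed.

Lemma conj_count_inv t w : conj_count t (w ++ inv_word w) = 0%R.
Proof.
elim: w t => [|[x e] w IH] t //.
rewrite /inv_word /= rev_cons -cats1 catA conj_count_cat IH word_val_cat word_valV.
by rewrite mulgV conjg1 add0r; apply: conj_count_cancel.
Qed.

(** The contributions of [w] and of its inverse cancel as in [w ++ inv_word w]; only the middle
    letter remains. *)
Lemma conj_count_conj w x e :
  conj_count (f x ^ (val w)^-1) (w ++ (x, e) :: inv_word w) = (if e then 1 else -1)%R.
Proof.
have := conj_count_inv (f x ^ (val w)^-1) w.
rewrite !conj_count_cat -conjgM mulVg conjg1 /= eqxx.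
have -> : f x ^ lval (x, e) = f x by apply/eqP; rewrite eq_sym conj_letter.
by lia.
Qed.

Lemma conj_count_sign t w e : (0 < (if e then 1 else -1) * conj_count t w)%R ->
  exists u x v, w = u ++ (x, e) :: v /\ f x = t ^ val u.
Proof.
elim: w t => [|[y e'] w IH] t /=; first by rewrite mulr0.
have [fy|_] := eqVneq (f y) t; last first.
  rewrite add0r => /IH[u [x [v [-> fx]]]].
  by exists ((y, e') :: u), x, v; rewrite word_val_cons conjgM.
have [-> _|ee'] := eqVneq e' e; first by exists [::], y, w; rewrite word_val_nil conjg1.
rewrite mulrDr => cw; have /IH[u [x [v [-> fx]]]] :
    (0 < (if e then 1 else -1) * conj_count (t ^ lval (y, e')) w)%R.
  by move: cw; clear IH; case: e ee'; case: e' => // _; lia.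
by exists ((y, e') :: u), x, v; rewrite word_val_cons conjgM.
Qed.

Lemma word_val_cancel x e : val [:: (x, e); (x, ~~ e)] = 1.
Proof.
rewrite !word_val_cons word_val_nil mulg1 -[(x, ~~ e)]/(inv_letter (x, e)).
by rewrite letter_valV mulgV.
Qed.

Section Exchange.
Variables (R : set (word X)) (q : int).
Hypothesis presR : presents [set: G] f R.
Hypothesis countR : forall r t, R r -> (q %| conj_count t r)%Z.
Hypothesis signR : q = 0%R \/ q = 2%R /\ forall x, f x * f x = 1.

Lemma word_eq_val u v : word_eq R u v -> val u = val v.
Proof. by case: presR => _ /(_ u v)[]. Qed.

Lemma relator_val r : R r -> val r = 1.
Proof.
move=> Rr; rewrite -word_val_nil; apply: word_eq_val.
by have := word_eq_relator [::] [::] Rr; rewrite /= cats0.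
Qed.

Lemma conj_count_word_eq u v t : word_eq R u v ->
  (q %| conj_count t u - conj_count t v)%Z.
Proof.
move=> uv; elim: uv t => {u v}.
- by move=> u t; rewrite subrr dvdz0.
- by move=> u v _ IH t; rewrite -opprB rpredN.
- move=> u v w _ IHu _ IHv t.
  by rewrite -(subrK (conj_count t v) (conj_count t u)) -addrA rpredD.
- move=> u v x e t; rewrite -[(x, e) :: _]/([:: (x, e); (x, ~~ e)] ++ v) !conj_count_cat.
  by rewrite conj_count_cancel add0r word_val_cancel conjg1 subrr dvdz0.
- move=> u v r Rr t; rewrite !conj_count_cat (relator_val Rr) conjg1.
  by rewrite addrCA addrK countR.
Qed.

(** At t = g x g^-1 the word for g a g^-1 has count 1 or -1, and counts of equal words agree modulo
    [q]. For q = 0 some letter of [w] contributes at [t] with the sign of [a]; for q = 2 the count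
    is odd, so some letter contributes, and signs do not matter for involutions. Removing that
    letter divides the value of [w] by a conjugate equal to this very value. *)
Lemma word_exchange w g a : val w = g * lval a * g^-1 ->
  exists2 w', deletion w w' 1 & val w' = 1.
Proof.
case: a => x e wE.
have [gw _ gE] : (range val) g by case: presR => -> _.
pose t := f x ^ g^-1.
have tE : lval (x, e) ^ g^-1 = val w by rewrite conjgE invgK wE !mulgA.
suff [u [y [e' [v [wuv fy]]]]] : exists u y e' v,
    w = u ++ (y, e') :: v /\ lval (y, e') = val w ^ val u.
  exists (u ++ v).
    rewrite wuv -[1%N]add0n; apply: deletion_cat; first exact: deletion_refl.
    by constructor; apply: deletion_refl.
  move/(congr1 val): wuv; rewrite word_val_cat word_val_cons fy conjgE.
  rewrite word_val_cat !mulgA mulgV mul1g -[LHS]mulg1 -mulgA.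
  by move=> /mulgI.
have /(conj_count_word_eq t) : word_eq R w (gw ++ (x, e) :: inv_word gw).
  case: presR => _ <-; rewrite wE word_val_cat word_val_cons word_valV gE.
  by rewrite mulgA.
rewrite {2}/t -gE conj_count_conj => qw.
case: signR => [q0|[q2 f2]].
  have [|u [y [v [wuv fy]]]] := @conj_count_sign t w e.
    move: qw; rewrite q0 dvd0z subr_eq0 => /eqP ->.
    by case: (e).
  exists u, y, e, v; split=> //; rewrite -tE; move: fy; rewrite /t /letter_val /=.
  by case: (e) => // ->; rewrite !conjVg.
have fE y e' : lval (y, e') = f y.
  by case: e' => //; rewrite /letter_val /=; apply: mulg1_eq.
have [e' cpos] : exists e', (0 < (if e' then 1 else -1) * conj_count t w)%R.
  have [N0|N0|N0] := ltrgtP 0%R (conj_count t w).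
  - by exists true; rewrite mul1r.
  - by exists false; rewrite mulN1r oppr_gt0.
  - by move: qw; rewrite q2 -N0; case: (e).
have [u [y [v [wuv fy]]]] := conj_count_sign cpos.
by exists u, y, e', v; split=> //; rewrite -tE !fE.
Qed.

End Exchange.

End Words.

Section Trivializable.
Variables (G : groupType) (X : Type) (f : X -> G).
Local Open Scope group_scope.
Implicit Types (u v w : word X) (a b : X * bool) (g t : G).
Local Notation val := (word_val f).
Local Notation lval := (letter_val f).

(** At most [l] deletions rather than exactly [l], since replacing a word by an equal one may save
    deletions. *)
Definition trivializable l w :=
  exists w' k, [/\ deletion w w' k, (k <= l)%N & val w' = 1].

Definition exchange := forall w g a, val w = g * lval a * g^-1 ->
  exists2 w', deletion w w' 1 & val w' = 1.

(* If exactly one of the two cancelling letters was deleted, the rest is a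
   conjugate of a letter, and the exchange property supplies another deletion. *)
Lemma trivializable_cancel l u a b v : exchange -> lval a * lval b = 1 ->
  trivializable l (u ++ a :: b :: v) <-> trivializable l (u ++ v).
Proof.
move=> exch ab; split=> -[w [k [d kl w1]]].
  have [u' [s [k1 [k2 [du ds wE kE]]]]] := deletion_catP d.
  subst w k.
  have one u1 v1 m c : deletion u u1 k1 -> deletion v v1 m ->
      val u1 * lval c * val v1 = 1 -> (k1 + m.+1 <= l)%N ->
      trivializable l (u ++ v).
    move=> du1 dv1 ucv ml; have [|w dw w'1] := exch (u1 ++ v1) (val u1) (inv_letter c).
      rewrite word_val_cat letter_valV.
      have -> : val v1 = (val u1 * lval c)^-1 by apply/esym/mulg1_eq.
      by rewrite invgM mulgA.
    exists w, (k1 + m + 1)%N; split=> //; last by rewrite addn1 -addnS.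
    exact: deletion_trans (deletion_cat du1 dv1) dw.
  have [[s' sE ds'] | [k2' k2E ds']] := deletion_consP ds; subst;
  have [[s2 s2E dv] | [k3 k3E dv]] := deletion_consP ds'; subst.
  - exists (u' ++ s2), (k1 + k2)%N; split=> //; first exact: deletion_cat.
    by move: w1; rewrite !word_val_cat !word_val_cons [lval a * _]mulgA ab mul1g.
  - apply: (one u' s' k3 a du dv) => //.
    by move: w1; rewrite word_val_cat word_val_cons mulgA.
  - apply: (one u' s2 k2' b du dv) => //.
    by move: w1; rewrite word_val_cat word_val_cons mulgA.
  - exists (u' ++ s), (k1 + k3)%N; split=> //; first exact: deletion_cat.
    by apply: leq_trans kl; rewrite leq_add2l ltnW.
have [u' [v' [k1 [k2 [du dv wE kE]]]]] := deletion_catP d.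
exists (u' ++ a :: b :: v'), k; split=> //.
  by rewrite kE; apply: deletion_cat => //; do 2!constructor.
move: w1; rewrite wE !word_val_cat !word_val_cons.
by rewrite [lval a * (_ * _)]mulgA ab mul1g.
Qed.

Lemma trivializable_rev l u s v : exchange -> (forall a, lval a * lval a = 1) ->
  trivializable l (u ++ (s ++ rev s) ++ v) <-> trivializable l (u ++ v).
Proof.
move=> exch f2; elim: s u v => [//|a s IH] u v.
rewrite rev_cons -cats1 -(trivializable_cancel l u v exch (f2 a)).
have := IH (u ++ [:: a]) (a :: v).
by rewrite -!catA.
Qed.

End Trivializable.

(** * Alternating words, dihedral groups and braid relations *)

Section Alternating.
Variable T : Type.

Fixpoint alternating n (a b : T) : seq T :=
  if n is n'.+1 then a :: alternating n' b a else [::].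

Lemma alternating_cat m n a b : alternating (m + n) a b =
  alternating m a b ++ (if odd m then alternating n b a else alternating n a b).
Proof. by elim: m a b => //= m IH a b; rewrite IH if_neg. Qed.

Lemma rev_alternating n a b : rev (alternating n a b) =
  if odd n then alternating n a b else alternating n b a.
Proof.
elim: n a b => // n IH a b; rewrite [in LHS]/= rev_cons -cats1 IH -addn1 !alternating_cat.
by rewrite oddD /= addbT; case: (odd n).
Qed.

Lemma flatten_alternating p a b :
  flatten (nseq p [:: a; b]) = alternating (p + p) a b.
Proof. by elim: p => //= p ->; rewrite addnS. Qed.

End Alternating.

Section Dihedral.
Variables (G : groupType) (X : Type) (f : X -> G).
Local Open Scope group_scope.
Local Notation val := (word_val f).
Local Notation lval := (letter_val f).
Variables (p : nat) (a b : X * bool).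
Local Notation A := (lval a).
Local Notation B := (lval b).
Hypotheses (p0 : (0 < p)%N) (A2 : A * A = 1) (B2 : B * B = 1).
Hypothesis AB : (A * B) ^+ p = 1.

(* [dihedral true] are the reflections of <A, B>, [dihedral false] the
   rotations. *)
Definition dihedral (e : bool) g := exists j, g = (A * B) ^+ j * (if e then A else 1).

Lemma AV : A^-1 = A. Proof. exact: mulg1_eq. Qed.
Lemma BV : B^-1 = B. Proof. exact: mulg1_eq. Qed.

(** Inverse rotations become powers with a natural exponent, the form demanded by [dihedral]. *)
Lemma rotationV j : (A * B) ^- j = (A * B) ^+ (p.-1 * j).
Proof.
apply: mulg1_eq; rewrite -expgnDr -mulSn prednK // expgnA AB.
exact: expg1n.
Qed.

Lemma reflectA j : A * (A * B) ^+ j = (A * B) ^- j * A.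
Proof.
have -> : (A * B) ^- j = (B * A) ^+ j by rewrite -expVgn invgM AV BV.
elim: j => [|j IH]; first by rewrite !expg0 mulg1 mul1g.
by rewrite !expgS -!mulgA -IH ![A * (A * _)]mulgA A2 !mul1g.
Qed.

Lemma dihedralM e e' g h : dihedral e g -> dihedral e' h -> dihedral (e (+) e') (g * h).
Proof.
move=> [j ->] [k ->]; case: e => /=.
  exists (j + p.-1 * k)%N.
  rewrite -mulgA [A * (_ * _)]mulgA reflectA rotationV expgnDr -!mulgA.
  by case: e' => /=; rewrite ?A2 ?mulg1.
by exists (j + k)%N; rewrite mulg1 expgnDr mulgA.
Qed.

Lemma dihedral_a : dihedral true A.
Proof. by exists 0%N; rewrite mul1g. Qed.

Lemma dihedral_b : dihedral true B.
Proof.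
exists (p.-1)%N; rewrite -[p.-1]muln1 -rotationV expg1 invgM BV AV -mulgA A2.
by rewrite mulg1.
Qed.

Lemma dihedralV e g : dihedral e g -> dihedral e g^-1.
Proof.
move=> [j ->]; case: e; rewrite ?mulg1.
  by exists j; rewrite invgM AV rotationV reflectA -rotationV invgK.
by exists (p.-1 * j)%N; rewrite rotationV mulg1.
Qed.

Lemma dihedral_reflection g : dihedral true g ->
  exists2 i, (i < p)%N & g = (A * B) ^+ i * A.
Proof.
move=> [j ->]; exists (j %% p)%N; first by rewrite ltn_mod.
by rewrite {1}(divn_eq j p) expgnDr mulnC expgnA AB expg1n mul1g.
Qed.

Lemma dihedral_deletion n r l :
  (deletion (alternating n a b) r l -> dihedral (odd (size r)) (val r)) /\
  (deletion (alternating n b a) r l -> dihedral (odd (size r)) (val r)).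
Proof.
have d1 : dihedral false (val [::]) by exists 0%N; rewrite word_val_nil mulg1.
elim: n r l => [|n IH] r l; first by split=> /deletion_nilP[-> _].
split=> /= d0; have [[r' -> d]|[l' _ d]] := deletion_consP d0.
- by rewrite word_val_cons; apply: (dihedralM dihedral_a); apply: (proj2 (IH _ _)) d.
- exact: (proj2 (IH _ _)) d.
- by rewrite word_val_cons; apply: (dihedralM dihedral_b); apply: (proj1 (IH _ _)) d.
- exact: (proj1 (IH _ _)) d.
Qed.

End Dihedral.

Section Braid.
Variables (G : groupType) (X : Type) (f : X -> G).
Local Open Scope group_scope.
Local Notation val := (word_val f).
Local Notation lval := (letter_val f).
Implicit Types (a b : X * bool).
Hypothesis f2 : forall a, lval a * lval a = 1.

Lemma lval_inv a : (lval a)^-1 = lval a.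
Proof. exact: mulg1_eq. Qed.

Lemma word_val_rev w : val (rev w) = (val w)^-1.
Proof.
elim: w => [|a w IH]; first by rewrite word_val_nil invg1.
rewrite rev_cons -cats1 word_val_cat IH !word_val_cons word_val_nil mulg1.
by rewrite invgM lval_inv.
Qed.

(** Deleting the letter at index [i] multiplies the value on the left by the conjugate of that
    letter by its prefix, which is the reflection (ab)^i a. For [n = p], [dihedral_reflection] shows
    that every reflection arises. *)
Lemma deletion_reflection n i a b : (i < n)%N ->
  exists2 r, deletion (alternating n a b) r 1 &
    val r = (lval a * lval b) ^+ i * lval a * val (alternating n a b).
Proof.
elim: n i a b => // n IH [|i] a b ilt.
  exists (alternating n b a); first by constructor; apply: deletion_refl.
  by rewrite mul1g word_val_cons mulgA f2 mul1g.
have [r d rE] := IH i b a ilt; exists (a :: r); first by constructor.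
rewrite !word_val_cons rE expgSr -!mulgA [lval a * (lval a * _)]mulgA f2 mul1g.
rewrite !mulgA; congr (_ * _ * _).
elim: (i) => [|j IHj]; first by rewrite mulg1 mul1g.
by rewrite !expgS -!mulgA -IHj.
Qed.

Lemma alternating_braid p a b : (lval a * lval b) ^+ p = 1 ->
  val (alternating p a b) = val (alternating p b a).
Proof.
move=> abp; have : val (alternating (p + p) a b) = 1.
  rewrite -flatten_alternating -abp; elim: (p) => [|k IH].
    by rewrite word_val_nil.
  by rewrite /= !word_val_cons IH expgS mulgA.
rewrite alternating_cat -rev_alternating word_val_cat word_val_rev.
by move=> /divg1_eq.
Qed.

(* Outside of the case where nothing is deleted, only the parity of the number
   of deleted letters matters: a product of [a]'s and [b]'s of odd length is a
   reflection, and a reflection can be removed from the other alternating word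
   by deleting one letter. *)
Lemma deletion_braid p a b r l : (0 < p)%N -> (lval a * lval b) ^+ p = 1 ->
  deletion (alternating p a b) r l -> exists r' l',
  [/\ (l' <= l)%N, deletion (alternating p b a) r' l' & val r' = val r].
Proof.
move=> p0 abp d; have bap : (lval b * lval a) ^+ p = 1.
  have := congr1 (fun g => g^-1) abp; rewrite /= -expVgn invgM !lval_inv invg1.
  by [].
have sz := deletion_size d.
have szalt n c e : size (@alternating (X * bool) n c e) = n.
  by elim: n c e => //= n IH c e; rewrite IH.
rewrite szalt in sz.
have quotient (g h : G) : g / h * h = g by rewrite mulgVK.
have [ol|el] := boolP (odd l).
  have dba := dihedral_deletion p0 (f2 b) (f2 a) bap p.
  have := dihedralM p0 (f2 b) (f2 a) bap (proj2 (dba r l) d)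
    (dihedralV p0 (f2 b) (f2 a) bap (proj1 (dba _ _) (deletion_refl _))).
  have -> : odd (size r) (+) odd (size (alternating p b a)) = true.
    by rewrite szalt -sz oddD ol; case: (odd _).
  move=> /(dihedral_reflection p0 bap)[i ip rE].
  have [r' d' r'E] := deletion_reflection b a ip.
  by exists r', 1%N; split=> //; [case: (l) ol | rewrite r'E -rE quotient].
case: l d sz el => [|[|l]] // d sz el.
  exists (alternating p b a), 0%N; split=> //; first exact: deletion_refl.
  by rewrite (deletion0 d) alternating_braid.
(* Two deletions are allowed from here on. The first removes the initial [b]; the letters that
   remain give every reflection but (ab)^p a, for the shifted [p]. That one equals [b], and then the
   other word has the right value without any deletion. *)
case: p p0 abp bap d sz => // p p0 abp bap d sz.
have dab n := dihedral_deletion p0 (f2 a) (f2 b) abp n.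
have := dihedralM p0 (f2 a) (f2 b) abp (proj1 (dab _ _ _) d)
  (dihedralV p0 (f2 a) (f2 b) abp (proj1 (dab p _ _) (deletion_refl _))).
have -> : odd (size r) (+) odd (size (alternating p a b)) = true.
  rewrite szalt; move: el (congr1 odd sz); rewrite oddD /= negbK.
  by case: (odd l) => // _; rewrite addbF => ->; case: (odd p).
move=> /(dihedral_reflection p0 abp)[i].
rewrite ltnS leq_eqVlt => /orP[/eqP -> rE|ip rE].
  exists (alternating p.+1 b a), 0%N; split=> //; first exact: deletion_refl.
  rewrite word_val_cons -[val r](quotient _ (val (alternating p a b))) rE.
  congr (_ * _); apply: (@mulgI _ (lval a * lval b)).
  by rewrite mulgA -expgS abp mul1g -mulgA f2 mulg1.
have [r' d' r'E] := deletion_reflection a b ip.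
by exists r', 2%N; split=> //; [constructor | rewrite r'E -rE quotient].
Qed.

Lemma trivializable_braid l p a b u v : (0 < p)%N -> (lval a * lval b) ^+ p = 1 ->
  trivializable f l (u ++ alternating p a b ++ v) ->
  trivializable f l (u ++ alternating p b a ++ v).
Proof.
move=> p0 abp [w [k [d kl w1]]].
have [u' [s [k1 [k2 [du ds wE kE]]]]] := deletion_catP d.
have [r [v' [k3 [k4 [dr dv sE k2E]]]]] := deletion_catP ds.
have [r' [k3' [k3le dr' r'r]]] := deletion_braid p0 abp dr.
exists (u' ++ r' ++ v'), (k1 + (k3' + k4))%N; split.
- by do 2!apply: deletion_cat => //.
- by apply: leq_trans kl; rewrite kE k2E leq_add2l leq_add2r.
- by rewrite -w1 wE sE !word_val_cat r'r.
Qed.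

End Braid.

Section DeletionNorm.
Variables (G : groupType) (X : Type) (f : X -> G) (R : set (word X)).
Local Open Scope group_scope.
Local Notation val := (word_val f).
Local Notation lval := (letter_val f).
Hypothesis presR : presents [set: G] f R.

Lemma pm_set_letter s : pm_set f s -> exists a, s = lval a.
Proof. by move=> [x [->|->]]; [exists (x, true) | exists (x, false)]. Qed.

Lemma word_surj g : exists w, val w = g.
Proof. by have [w _ <-] : (range val) g; [case: presR => -> | exists w]. Qed.

Lemma conj_product_word l g : conj_product (pm_set f) l g ->
  exists w w', [/\ val w = g, deletion w w' l & val w' = 1].
Proof.
elim=> [|{}l h s {}g /pm_set_letter[a ->] _ [w [w' [<- d w'1]]]].
  by exists [::], [::]; rewrite word_val_nil; split=> //; constructor.
have [hw <-] := word_surj h.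
exists (hw ++ a :: inv_word hw ++ w), (hw ++ inv_word hw ++ w'); split.
- by rewrite !(word_val_cat, word_val_cons) word_valV !mulgA.
- rewrite -[l.+1]add0n; apply: deletion_cat; first exact: deletion_refl.
  constructor; rewrite -[l]add0n; apply: deletion_cat => //.
  exact: deletion_refl.
- by rewrite !word_val_cat word_valV w'1 mulg1 mulgV.
Qed.

(** A product of conjugates provides a word with deletions of its own, in general different from
    [w]; [triv_eq] carries the deletions over to [w]. *)
Lemma conj_norm_deletion w :
  (forall l u v, word_eq R u v -> trivializable f l u -> trivializable f l v) ->
  conj_norm (pm_set f) (val w) =
  enat_inf [set l | exists w', deletion w w' l /\ val w' = 1].
Proof.
move=> triv_eq; rewrite conj_normE.
have del_prod l w' : deletion w w' l -> val w' = 1 -> conj_product (pm_set f) l (val w).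
  move=> d w'1; have := @deletion_conj_product _ _ f _ _ _ 0 1 d.
  by rewrite !mul1g addn0 w'1; apply; constructor.
have [[l [-> [w' [d w'1]] minl]]|[-> nodel]] :=
    enat_infP [set l | exists w', deletion w w' l /\ val w' = 1].
  apply: enat_inf_Some => [|k /conj_product_word[u [u' [uw du u'1]]]].
    exact: del_prod d w'1.
  have [v [j [dv jk v1]]] : trivializable f k w.
    apply: (triv_eq k u); first by case: presR => _ <-.
    by exists u', k.
  by apply: leq_trans jk; apply: minl; exists v.
have [[k [_ /conj_product_word[u [u' [uw du u'1]]] _]]|[]//] :=
  enat_infP [set l | conj_product (pm_set f) l (val w)].
have [v [j [dv jk v1]]] : trivializable f k w.
  apply: (triv_eq k u); first by case: presR => _ <-.
  by exists u', k.
by have [] := nodel j; exists v.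
Qed.

Lemma trivializable_word_eq : exchange f ->
  (forall l u v r, R r -> trivializable f l (u ++ r ++ v) <-> trivializable f l (u ++ v)) ->
  forall l u v, word_eq R u v -> trivializable f l u -> trivializable f l v.
Proof.
move=> exch trivR l u v uv; suff [] : trivializable f l u <-> trivializable f l v by [].
elim: uv => {u v} //.
- by move=> u v _ ->.
- by move=> u v w _ -> _ ->.
- move=> u v x e; apply: trivializable_cancel => //.
  by have := word_val_cancel f x e; rewrite !word_val_cons word_val_nil mulg1.
- by move=> u v r; apply: trivR.
Qed.

End DeletionNorm.

(** * Exchange and braid moves in Coxeter groups *)

Section CoxeterGroup.
Variables (G : groupType) (X : Type) (f : X -> G) (m : X -> X -> option nat).
Local Open Scope group_scope.
Local Notation val := (word_val f).
Local Notation lval := (letter_val f).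
Hypothesis mP : coxeter_labels m.
Hypothesis presf : presents [set: G] f (coxeter_relator m).

Lemma coxeter_involution x : f x * f x = 1.
Proof.
have := relator_val presf (coxeter_square m x).
by rewrite !word_val_cons word_val_nil mulg1.
Qed.

Lemma coxeter_letter a : lval a * lval a = 1.
Proof.
case: a => x []; rewrite /letter_val /= ?coxeter_involution //.
by rewrite -invgM coxeter_involution invg1.
Qed.

Lemma conj_count_alternating t n x y :
  conj_count f t (alternating n (x, true) (y, true)) =
  (\sum_(i < n) ((f x * f y) ^+ i * f x == t)%g%:R)%R.
Proof.
elim: n t x y => [|n IH] t x y; first by rewrite big_ord0.
rewrite big_ord_recl mul1g /= IH; congr (_ + _)%R; first by case: eqP.
apply: eq_bigr => i _; congr (_%:R)%R; congr nat_of_bool.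
rewrite -[RHS](inj_eq (@conjg_inj _ (f x))); congr (_ == _).
have -> : (f y * f x) ^+ i * f y = f y * (f x * f y) ^+ i.
  elim: (nat_of_ord i) => [|j IHj]; first by rewrite !expg0 mulg1 mul1g.
  by rewrite !expgS -!mulgA IHj.
have fV : (f x)^-1 = f x by apply: mulg1_eq; apply: coxeter_involution.
rewrite conjgE fV -mulgA coxeter_involution mulg1 /bump add1n expgS !mulgA.
by rewrite coxeter_involution mul1g.
Qed.

Lemma braid_relation p x y : val (flatten (nseq p [:: (x, true); (y, true)])) = 1 ->
  (f x * f y) ^+ p = 1.
Proof.
move=> <-; elim: p => [|p IH] /=; first by rewrite word_val_nil.
by rewrite !word_val_cons -IH expgS mulgA.
Qed.

(** In (xy)^p the letters at positions i and i + p define the same reflection because (xy)^p = 1, so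
    every reflection is met an even number of times. *)
Lemma conj_count_coxeter r t : coxeter_relator m r -> (2 %| conj_count f t r)%Z.
Proof.
case=> [x|x y p xy mxy].
  by rewrite /= conj_letter; case: eqP.
have c1 := relator_val presf (coxeter_braid xy mxy).
rewrite flatten_alternating conj_count_alternating big_split_ord /=.
set s := (\sum_(i < p) _)%R; rewrite (_ : (_ + _)%R = (s * 2)%R) ?dvdz_mull //.
rewrite mulr_natr mulr2n; congr (_ + _)%R; apply: eq_bigr => i _.
by rewrite expgnDr (braid_relation c1) mul1g.
Qed.

Lemma coxeter_exchange : exchange f.
Proof.
apply: (word_exchange (q := 2) presf) => [r t|]; first exact: conj_count_coxeter.
by right; split=> // x; apply: coxeter_involution.
Qed.

(** A braid move turns the first half of the relator (ab)^p into the reversal of the second half,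
    after which the whole cancels letter by letter. *)
Lemma trivializable_coxeter l u v r : coxeter_relator m r ->
  trivializable f l (u ++ r ++ v) <-> trivializable f l (u ++ v).
Proof.
move=> mr; case: mr (relator_val presf mr) => [x _|x y p xy mxy].
  exact: trivializable_cancel coxeter_exchange (coxeter_letter _).
move=> /braid_relation; set a := (x, true); set b := (y, true) => abp.
rewrite -[f x]/(lval a) -[f y]/(lval b) in abp.
have bap : (lval b * lval a) ^+ p = 1.
  have := congr1 (fun g => g^-1) abp.
  by rewrite -expVgn invgM !(lval_inv coxeter_letter) invg1.
have p0 : (0 < p)%N by have [_ /(_ p mxy)] := mP xy; case: (p).
have altE : alternating (p + p) a b = alternating p a b ++ rev (alternating p b a).
  by rewrite alternating_cat rev_alternating.
rewrite flatten_alternating altE.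
rewrite -(trivializable_rev l u (alternating p b a) v coxeter_exchange coxeter_letter).
by rewrite -!catA; split; apply: trivializable_braid => //; apply: coxeter_letter.
Qed.

End CoxeterGroup.

Lemma conj_norm_word (G : groupType) (X : Type) (f : X -> G) (w : word X) :
  freely_generates [set: G] f \/ coxeter_presentation f ->
  conj_norm (pm_set f) (word_val f w) =
  enat_inf [set l | exists w', deletion w w' l /\ word_val f w' = 1%g].
Proof.
case=> [presf|[m [mP presf]]]; apply: (conj_norm_deletion presf).
  apply: trivializable_word_eq => //.
  by apply: (word_exchange (q := 0) presf) => //; left.
apply: trivializable_word_eq; first exact: coxeter_exchange presf.
by move=> l u v r; apply: trivializable_coxeter.
Qed.

(** * Bracketings in virtually free groups *)

Section Parsing.
Variable G : groupType.
Local Open Scope group_scope.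
Implicit Types (E S : seq G) (q y z : G).
Local Notation gprod s := (\prod_(y <- s) y).

(** Binary trees in which every subtree has its product in [E]: for finite [E], derivation trees of
    a context-free grammar whose nonterminals are the elements of [E]. *)
Inductive parses E : seq G -> Prop :=
| parses1 y : y \in E -> parses E [:: y]
| parses_cat u v : parses E u -> parses E v -> gprod (u ++ v) \in E ->
    parses E (u ++ v).

Lemma parses_prod E u : parses E u -> gprod u \in E.
Proof. by case=> // y yE; rewrite big_seq1. Qed.

Lemma parses_neq0 E : ~ parses E [::].
Proof.
suff H u : parses E u -> u <> [::] by move/H.
by elim=> // {}u v _ u0 _ _ _; case: u u0.
Qed.

Lemma parses_sub E E' u : {subset E <= E'} -> parses E u -> parses E' u.
Proof.
move=> EE'; elim=> [y /EE' yE'|{}u v _ pu _ pv /EE' uvE']; first by constructor.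
exact: parses_cat.
Qed.

(* A transducer with states in [S] reading [zs] and writing [ys]; the states
   record the element by which the two partial products differ. *)
Inductive transduces S : G -> seq G -> G -> seq G -> Prop :=
| transduces_nil q : transduces S q [::] q [::]
| transduces_emit q q' q'' z y zs ys : q' \in S -> z * q' = q * y ->
    transduces S q' zs q'' ys -> transduces S q (z :: zs) q'' (y :: ys)
| transduces_skip q q' q'' z zs ys : q' \in S -> z * q' = q ->
    transduces S q' zs q'' ys -> transduces S q (z :: zs) q'' ys.

Lemma transduces_prod S q zs q' ys :
  transduces S q zs q' ys -> gprod zs * q' = q * gprod ys.
Proof.
elim=> [{}q|{}q p {}q' z y {}zs {}ys _ zp _ IH|{}q p {}q' z {}zs {}ys _ zp _ IH].
- by rewrite !big_nil mul1g mulg1.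
- by rewrite !big_cons -mulgA IH mulgA zp mulgA.
- by rewrite big_cons -mulgA IH mulgA zp.
Qed.

Lemma transduces_state S q zs q' ys : transduces S q zs q' ys -> q \in S -> q' \in S.
Proof. by elim=> // *; auto. Qed.

Lemma transduces_cat S q zs q' ys zs' q'' ys' :
  transduces S q zs q' ys -> transduces S q' zs' q'' ys' ->
  transduces S q (zs ++ zs') q'' (ys ++ ys').
Proof.
move=> d d'; elim: d d' => // {q q' zs ys}.
  by move=> q p q' z y zs ys pS zp _ IH /IH; apply: transduces_emit.
by move=> q p q' z zs ys pS zp _ IH /IH; apply: transduces_skip.
Qed.

Lemma transduces_consP S q z zs q'' ys : transduces S q (z :: zs) q'' ys ->
  exists2 q', q' \in S &
    (exists y ys', [/\ ys = y :: ys', z * q' = q * y & transduces S q' zs q'' ys']) \/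
    (z * q' = q /\ transduces S q' zs q'' ys).
Proof.
move zE: (z :: zs) => zs' d; case: d zE => // {}q q' {}q'' z'.
  move=> y {}zs' {}ys q'S zq d [-> ->]; exists q' => //; left.
  by exists y, ys.
by move=> {}zs' {}ys q'S zq d [-> ->]; exists q' => //; right.
Qed.

Lemma transduces_nilP S q q' ys : transduces S q [::] q' ys -> q = q' /\ ys = [::].
Proof. by move zE: [::] => zs d; case: d zE. Qed.

Lemma transduces_catP S q zs zs' q'' ys : transduces S q (zs ++ zs') q'' ys ->
  exists q' ys1 ys2, [/\ transduces S q zs q' ys1, transduces S q' zs' q'' ys2 &
    ys = ys1 ++ ys2].
Proof.
elim: zs q ys => [|z zs IH] q ys /=.
  by move=> d; exists q, [::], ys; split=> //; constructor.
case/transduces_consP=> p pS [[y [ys' [-> zp /IH]]]|[zp /IH]] [q' [ys1 [ys2 [d1 d2 ->]]]].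
  by exists q', (y :: ys1), ys2; split=> //; apply: transduces_emit d1.
by exists q', ys1, ys2; split=> //; apply: transduces_skip d1.
Qed.

Definition twist S E :=
  [seq qq.1^-1 * e * qq.2 | qq <- [seq (q, q') | q <- S, q' <- S], e <- E].

Lemma twist_in S E q q' e : q \in S -> q' \in S -> e \in E -> q^-1 * e * q' \in twist S E.
Proof.
move=> qS q'S eE; apply/allpairsP; exists ((q, q'), e); split=> //.
by apply/allpairsP; exists (q, q').
Qed.

(** A subtree with product z, read from state q to state q', has output product q^-1 z q', which
    lies in [twist S E]. Subtrees with empty output are pruned. *)
Lemma parses_transduces S E q zs q' ys : parses E zs -> transduces S q zs q' ys ->
  q \in S -> ys = [::] \/ parses (twist S E) ys.
Proof.
move=> pzs; elim: pzs q q' ys => [z zE|u v pu IHu pv IHv uvE] q q' ys.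
  case/transduces_consP=> p pS.
  case=> [[y [ys' [-> zp /transduces_nilP[_ ->]]]]|[_ /transduces_nilP[_ ->]]] qS.
    right; constructor; have -> : y = q^-1 * z * p by rewrite -mulgA zp mulKg.
    exact: twist_in.
  by left.
move=> d qS; have [p [ys1 [ys2 [d1 d2 ysE]]]] := transduces_catP d.
have pS := transduces_state d1 qS; have q'S := transduces_state d2 pS.
have [ys10|p1] := IHu _ _ _ d1 qS; first by rewrite ysE ys10; apply: IHv d2 pS.
have [ys20|p2] := IHv _ _ _ d2 pS; first by rewrite ysE ys20 cats0; right.
right; rewrite ysE; apply: parses_cat => //; rewrite -ysE.
have -> : gprod ys = q^-1 * gprod (u ++ v) * q'.
  by rewrite -mulgA (transduces_prod d) mulKg.
exact: twist_in.
Qed.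

End Parsing.

(** * Free reduction read as bracketing *)

Section FreeReduction.
Variable B : Type.
Implicit Types (l : B * bool) (r u v w : word B).

Definition push l r : word B :=
  if r is l' :: r' then if `[< l' = inv_letter l >] then r' else l :: r else [:: l].

Definition reduce w : word B := foldr push [::] w.

Fixpoint reduced r : Prop :=
  if r is l :: r' then (if r' is l' :: _ then l' <> inv_letter l else True) /\ reduced r'
  else True.

Lemma inv_letterK : involutive (@inv_letter B).
Proof. by case=> x e; rewrite /inv_letter /= negbK. Qed.

Lemma reduced_push l r : reduced r -> reduced (push l r).
Proof. by case: r => [|l' r] //= [hr rr]; case: asboolP. Qed.

Lemma reduced_reduce w : reduced (reduce w).
Proof. by elim: w => //= l w; apply: reduced_push. Qed.

Lemma pushK l r : reduced r -> push l (push (inv_letter l) r) = r.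
Proof.
case: r => [|l' r] /=; first by case: asboolP.
case=> hr rr; case: asboolP => [l'E|_] /=; last by case: asboolP.
rewrite inv_letterK in l'E; rewrite l'E in hr *.
by case: r hr {rr} => //= l'' r; case: asboolP.
Qed.

(** Van der Waerden's argument: by [pushK] a letter and its inverse act on reduced words as inverse
    maps, so cancelling pairs do not affect the fold. *)
Lemma reduce_word_eq u v : word_eq set0 u v -> reduce u = reduce v.
Proof.
elim=> {u v} // [u v w _ -> _ -> //|u v x e].
rewrite /reduce !foldr_cat /= -/(reduce v); congr foldr.
by apply: (@pushK (x, e)); apply: reduced_reduce.
Qed.

End FreeReduction.

Section FreeParsing.
Variables (G : groupType) (H : set G) (B : Type) (b : B -> G).
Local Open Scope group_scope.
Hypothesis freeH : freely_generates H b.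
Local Notation gprod s := (\prod_(y <- s) y).
Local Notation lval := (letter_val b).
Variable E : seq G.
Hypothesis E1 : 1 \in E.

(* [stacks r zs] when reading [zs] can leave the letters of [r] on a stack, each
   standing for a bracketed segment with that value. *)
Inductive stacks : word B -> seq G -> Prop :=
| stacks_nil : stacks [::] [::]
| stacks_trivial zs : parses E zs -> gprod zs = 1 -> stacks [::] zs
| stacks_cons l r zs zs' : parses E zs -> gprod zs = lval l -> stacks r zs' ->
    stacks (l :: r) (zs ++ zs').

Lemma stacks_merge zs r zs' : parses E zs -> gprod zs = 1 -> stacks r zs' ->
  stacks r (zs ++ zs').
Proof.
move=> pz z1; case=> [|{}zs' pz' z'1|l {}r us vs pu ul rv].
- by rewrite cats0; apply: stacks_trivial.
- have zz'1 : gprod (zs ++ zs') = 1 by rewrite big_cat /= z1 z'1 mul1g.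
  by apply: stacks_trivial => //; apply: parses_cat => //; rewrite zz'1.
rewrite catA; have zu : gprod (zs ++ us) = lval l by rewrite big_cat /= z1 mul1g.
apply: stacks_cons => //; apply: parses_cat => //.
by rewrite zu -ul; apply: parses_prod.
Qed.

Lemma stacks_nilP zs : stacks [::] zs -> zs = [::] \/ parses E zs.
Proof. by move rE: [::] => r st; case: st rE => // *; [left | right]. Qed.

(** [None] is a blank of value 1; it lets the input block for a trivial element be nonempty. *)
Definition symbol_val (o : option (B * bool)) : G := oapp lval 1 o.

(** A cancelling letter and the top segment are bracketed into a segment of value 1, which the next
    segment absorbs. Every bracket formed has value 1 or that of a letter already read, so it stays
    in [E]. *)
Lemma stacks_reduce (s : seq (option (B * bool))) :
  all (fun o => symbol_val o \in E) s ->
  stacks (reduce (pmap id s)) (map symbol_val s).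
Proof.
elim: s => [|o s IH] /=; first by constructor.
case/andP=> oE /IH {}IH; rewrite -[_ :: map _ _]cat1s.
case: o oE => [l|] oE; rewrite [pmap _ _]/=; last first.
  by apply: stacks_merge; [constructor | rewrite big_seq1 | ].
rewrite -[reduce _]/(push l (reduce (pmap id s))) -[symbol_val _]/(lval l).
have cons_l r zs : stacks r zs -> stacks (l :: r) ([:: lval l] ++ zs).
  by move=> rzs; apply: stacks_cons => //; [constructor | rewrite big_seq1].
case: IH => [|zs pz z1|l' r us vs pu ul' rv].
- by apply: cons_l; constructor.
- by apply: cons_l; apply: stacks_trivial.
rewrite /push; case: asboolP => [l'E|_]; last by apply: cons_l; apply: stacks_cons.
have lu1 : gprod ([:: lval l] ++ us) = 1.
  by rewrite big_cons ul' l'E letter_valV mulgV.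
rewrite catA; apply: stacks_merge => //.
by apply: parses_cat => //; [constructor | rewrite lu1].
Qed.

Lemma parses_free (s : seq (option (B * bool))) :
  all (fun o => symbol_val o \in E) s -> gprod (map symbol_val s) = 1 ->
  s = [::] \/ parses E (map symbol_val s).
Proof.
move=> sE s1; have : word_val b (pmap id s) = word_val b [::].
  rewrite word_val_nil -s1; elim: s {sE s1} => [|[l|] s IH] /=.
  - by rewrite word_val_nil big_nil.
  - by rewrite word_val_cons IH big_cons.
  - by rewrite IH big_cons mul1g.
case: freeH => _ /[apply] /reduce_word_eq /= r0.
have := stacks_reduce sE; rewrite r0 => /stacks_nilP[s0|]; last by right.
by left; apply: size0nil; rewrite -(size_map symbol_val) s0.
Qed.

End FreeParsing.

(** * Schreier rewriting for a free subgroup of finite index *)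

Section VirtuallyFree.
Variable G : groupType.
Local Open Scope group_scope.
Local Notation gprod s := (\prod_(y <- s) y).

Lemma free_virtually_free (X : Type) (f : X -> G) :
  freely_generates [set: G] f -> virtually_free G.
Proof.
move=> freef; exists [set: G]; split; last by exists X, f.
apply: (sub_finite_set _ (finite_set1 [set: G])) => _ [g _ <-].
by apply/seteqP; split=> // h _; exists (g^-1 * h); rewrite // mulVKg.
Qed.

Lemma coset_representatives (H : set G) : finite_index H -> H 1 ->
  (forall g h, H g -> H h -> H (g^-1 * h)) ->
  exists (tau : G -> G) (T : seq G),
    [/\ forall g, tau g \in T, forall g, H (g^-1 * tau g) &
        forall g h, H (g^-1 * h) -> tau g = tau h].
Proof.
move=> finH H1 Hdiv; pose coset g := [set g * h | h in H].
pose tau g := xget 1 (coset g).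
have [T TE] : exists T : seq G, [set tau g | g in setT] = [set` T].
  apply/finite_seqP; rewrite (_ : [set tau g | g in setT] = xget 1 @` range coset).
    exact: finite_image.
  by rewrite image_comp.
exists tau, T; split.
- by move=> g; have : [set tau g | g in setT] (tau g) by [exists g]; rewrite TE.
- move=> g; rewrite /tau; case: xgetP => [_ _ [h Hh <-]|/(_ g)[]]; first by rewrite mulKg.
  by exists 1; rewrite ?mulg1.
move=> g h Hgh; congr xget; apply/seteqP; split=> _ [k Hk <-].
  exists (h^-1 * g * k); last by rewrite -!mulgA mulVKg.
  have -> : h^-1 * g * k = (g^-1 * h)^-1 * k by rewrite invgM invgK.
  exact: Hdiv.
exists (g^-1 * h * k); last by rewrite -!mulgA mulVKg.
have -> : g^-1 * h * k = ((g^-1 * h)^-1 * 1)^-1 * k by rewrite mulg1 invgK.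
by apply: (Hdiv) => //; apply: Hdiv.
Qed.

(** With q and q' representing the cosets of [H] before and after a letter y, the element q y q'^-1
    lies in [H] and in the finite set [Z]. Writing these elements in the free generators gives a
    word of value 1, which [parses_free] brackets; the transducer reads it, writes [ys] and so
    transfers the bracketing. *)
Theorem virtually_free_parses (Y : seq G) : virtually_free G ->
  exists E : seq G, forall ys : seq G, {subset ys <= Y} -> gprod ys = 1 ->
    ys = [::] \/ parses E ys.
Proof.
case=> H [finH [B [b freeH]]].
have [rangeH _] := freeH.
have H1 : H 1 by rewrite -rangeH; exists [::]; rewrite ?word_val_nil.
have Hdiv g h : H g -> H h -> H (g^-1 * h).
  rewrite -rangeH => -[u _ <-] [v _ <-]; exists (inv_word u ++ v) => //.
  by rewrite word_val_cat word_valV.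
have [tau [T [tauT tauH tau_eq]]] := coset_representatives finH H1 Hdiv.
have /choice[zeta zetaE] : forall z, exists w, H z -> word_val b w = z.
  move=> z; have [Hz|nHz] := pselect (H z); last by exists [::].
  by move: Hz; rewrite -rangeH => -[w _ <-]; exists w.
pose Z := [seq (ty.1)^-1 * ty.2 * t' | ty <- [seq (t, y) | t <- T, y <- Y], t' <- T].
have ZP t y t' : t \in T -> y \in Y -> t' \in T -> t^-1 * y * t' \in Z.
  move=> tT yY t'T; apply/allpairsP; exists ((t, y), t'); split=> //.
  by apply/allpairsP; exists (t, y).
pose E0 := 1 :: flatten [seq map (letter_val b) (zeta z) | z <- Z].
(* States between blocks are inverses of representatives; inside a block, the value of the free word
   still to be read times such an inverse. *)
pose S := [seq t^-1 | t <- T] ++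
  flatten [seq [seq word_val b (drop i (zeta z)) * t^-1 | i <- iota 0 (size (zeta z)).+1]
    | z <- Z, t <- T].
have ST t : t \in T -> t^-1 \in S by move=> tT; rewrite mem_cat map_f.
have Ssuffix z u v t : z \in Z -> t \in T -> zeta z = u ++ v -> word_val b v * t^-1 \in S.
  move=> zZ tT uv; rewrite mem_cat; apply/orP; right; apply/flattenP.
  exists [seq word_val b (drop i (zeta z)) * t^-1 | i <- iota 0 (size (zeta z)).+1].
    by apply/allpairsP; exists (z, t).
  apply/mapP; exists (size u); last by rewrite uv drop_size_cat.
  by rewrite mem_iota /= add0n ltnS uv size_cat leq_addr.
have block q y t' : q^-1 \in T -> y \in Y -> t' \in T -> H (q * y * t') ->
    exists s, [/\ all (fun o => symbol_val b o \in E0) s, s <> [::] &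
      transduces S q (map (symbol_val b) s) t'^-1 [:: y]].
  move=> qT yY t'T Hz; set z := q * y * t'.
  have zZ : z \in Z by have := ZP _ _ _ qT yY t'T; rewrite invgK.
  (* The leading blank is where [y] is written, and it keeps the block nonempty when [zeta z] is
     empty; the letters of [zeta z] are then read without output. *)
  exists (None :: map Some (zeta z)); split=> //.
    rewrite /= mem_head all_map.
    have zE l : l \in map (letter_val b) (zeta z) -> l \in E0.
      move=> lz; rewrite inE; apply/orP; right; apply/flattenP.
      by eexists; first exact: map_f zZ.
    elim: (zeta z) zE => //= l w IH zE; rewrite zE ?mem_head //=.
    by apply: IH => l' l'w; apply: zE; rewrite inE l'w orbT.
  have suffixes u v : zeta z = u ++ v -> transduces S (word_val b v * t'^-1)
      (map (symbol_val b) (map Some v)) t'^-1 [::].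
    elim: v u => [|l v IH] u uv; first by rewrite word_val_nil mul1g; constructor.
    apply: (@transduces_skip _ _ _ (word_val b v * t'^-1)).
    - by apply: (Ssuffix z (u ++ [:: l])) => //; rewrite uv -catA.
    - by rewrite word_val_cons mulgA.
    - by apply: (IH (u ++ [:: l])); rewrite uv -catA.
  apply: (@transduces_emit _ _ _ (word_val b (zeta z) * t'^-1)).
  - exact: (Ssuffix z [::]).
  - by rewrite zetaE // mul1g /z mulgK.
  - exact: (suffixes [::]).
(* Since [tau] chooses from left cosets, [g * tau g^-1] lies in [H], so the state [(tau g^-1)^-1]
   represents the right coset H g. *)
have run g ys : {subset ys <= Y} -> exists s,
    [/\ all (fun o => symbol_val b o \in E0) s, s = [::] -> ys = [::] &
     transduces S (tau g^-1)^-1 (map (symbol_val b) s) (tau (g * gprod ys)^-1)^-1 ys].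
  elim: ys g => [|y ys IH] g ysY.
    by exists [::]; rewrite big_nil mulg1; split=> //; constructor.
  have [s [sE _ ds]] := IH (g * y) (fun x xs => ysY x (mem_behead (s := y :: ys) xs)).
  have [||||s0 [s0E s0n d0]] := block (tau g^-1)^-1 y (tau (g * y)^-1).
  - by rewrite invgK.
  - by apply: ysY; rewrite mem_head.
  - by [].
  - have := Hdiv _ _ (tauH g^-1) (tauH (g * y)^-1).
    by rewrite !invgM !invgK !mulgA mulgVK.
  exists (s0 ++ s); split.
  - by rewrite all_cat s0E.
  - by case: s0 s0n {s0E d0}.
  - rewrite map_cat -cat1s big_cons mulgA; exact: transduces_cat d0 ds.
exists (twist S E0) => ys ysY ys1.
have [s [sE sys d]] := run 1 ys ysY.
have s1 : gprod (map (symbol_val b) s) = 1.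
  by have := transduces_prod d; rewrite ys1 !mulg1 => /(canRL (mulgK _)); rewrite mulgV.
have [/sys|ps] := parses_free freeH (mem_head 1 _) sE s1; first by left.
by apply: parses_transduces ps d _; apply: ST.
Qed.

End VirtuallyFree.

(** * The norm of products of powers *)

Lemma word_val_flatten (G : groupType) (X : Type) (f : X -> G) (ws : seq (word X)) :
  word_val f (flatten ws) = (\prod_(w <- ws) word_val f w)%g.
Proof. exact: big_flatten. Qed.

Lemma finite_deletions (G : groupType) (X : Type) (f : X -> G) (w : word X) :
  exists D : seq (G * nat), forall v c,
    (v, c) \in D <-> exists w', deletion w w' c /\ word_val f w' = v.
Proof.
elim: w => [|a w [D DP]].
  exists [:: (1%g, 0%N)] => v c; split.
    rewrite inE => /eqP[-> ->]; exists [::]; rewrite word_val_nil.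
    by split=> //; constructor.
  by case=> w' [/deletion_nilP[-> ->] <-]; rewrite word_val_nil mem_head.
exists ([seq ((letter_val f a * vc.1)%g, vc.2) | vc <- D] ++
  [seq (vc.1, vc.2.+1) | vc <- D]).
move=> v c; rewrite mem_cat; split.
  case/orP=> /mapP[[v' c'] /DP[w' [d <-]] [-> ->]].
    by exists (a :: w'); rewrite word_val_cons; split=> //; constructor.
  by exists w'; split=> //; constructor.
case=> w' [dw' w'v]; have [[t wE d]|[l cE d]] := deletion_consP dw'; subst.
  apply/orP; left; apply/mapP; exists (word_val f t, c).
    by apply/DP; exists t.
  by rewrite word_val_cons.
apply/orP; right; apply/mapP; exists (word_val f w', l) => //.
by apply/DP; exists w'.
Qed.

(** * The grammar of deletions from products of powers *)

Section PowerGrammar.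
Variables (G : groupType) (n : nat) (D : 'I_n.+1 -> seq (G * nat)) (E : seq G).
Local Notation gprod s := (\prod_(y <- s) y)%g.
(* A pair of a factor index and a value-and-cost pair of that factor. *)
Local Notation choice := ('I_n.+1 * (G * nat))%type.
Implicit Types (s : choice) (ss : seq choice).

Definition choice_val s : G := s.2.1.

Definition choices_ok ss := all (fun s => s.2 \in D s.1) ss.

Definition in_order ss := pairwise (fun s s' : choice => (s.1 <= s'.1)%N) ss.

Definition cost ss := sumn [seq s.2.2 | s <- ss].

Definition yield ss : {ffun 'I_n.+1 -> nat} * nat :=
  ([ffun i => count_mem i [seq s.1 | s <- ss]], cost ss).

(* [(e, i, j)] generates the ordered sequences of choices, with factor indices
   between [i] and [j], whose values have product [e]. *)
Local Notation nonterminal := (seq_sub E * 'I_n.+1 * 'I_n.+1)%type.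
Implicit Types A B C : nonterminal.

Definition node A B C := [&& ssval A.1.1 == (ssval B.1.1 * ssval C.1.1)%g,
  (A.1.2 <= B.1.2)%N, (B.2 <= C.1.2)%N & (C.2 <= A.2)%N].

Definition leaf A := [seq yield [:: (i, vc)] |
  i <- [seq i : 'I_n.+1 <- enum 'I_n.+1 | (A.1.2 <= i <= A.2)%N],
  vc <- [seq vc <- D i | vc.1 == ssval A.1.1]].

Definition derives A ss := [/\ choices_ok ss, in_order ss,
  all (fun s => (A.1.2 <= s.1 <= A.2)%N) ss & gprod (map choice_val ss) = ssval A.1.1].

Lemma yield_cat ss ss' : yield (ss ++ ss') = yield ss + yield ss'.
Proof.
congr pair; last by rewrite /cost map_cat sumn_cat.
by apply/ffunP => i; rewrite !ffunE map_cat count_cat.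
Qed.

Lemma leafP A i vc : vc \in D i -> (A.1.2 <= i <= A.2)%N -> vc.1 = ssval A.1.1 ->
  yield [:: (i, vc)] \in leaf A.
Proof.
move=> vcD iA vcA; apply/allpairsPdep; exists i, vc; split=> //.
  by rewrite mem_filter iA mem_enum.
by rewrite mem_filter vcA eqxx.
Qed.

(** The inequality on the bounds of [A] goes through the induction because a choice made below [B]
    is compared with the upper bound of [A] through the interval of [C]. *)
Lemma generates_derives A y : generates node leaf A y -> (A.1.2 <= A.2)%N /\
  exists2 ss, derives A ss & y = yield ss.
Proof.
elim=> {A y} [A y|A B C u w /and4P[/eqP AE AB BC CA]
    _ [BB [ss [okB ordB allB prodB] ->]] _ [CC [ss' [okC ordC allC prodC] ->]]].
  case/allpairsPdep=> i [vc [+ + ->]].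
  rewrite !mem_filter => /andP[iA _] /andP[/eqP vcA vcD].
  split; first by case/andP: iA => /leq_trans; apply.
  exists [:: (i, vc)] => //; split; rewrite /choices_ok /= ?andbT //.
  by rewrite big_seq1.
split; first lia.
exists (ss ++ ss'); last by rewrite yield_cat.
split.
- by rewrite /choices_ok all_cat; apply/andP.
- rewrite /in_order pairwise_cat; apply/and3P; split=> //.
  apply/allrelP => s s' /(allP allB) /andP[_ sB] /(allP allC) /andP[Cs _].
  by apply: leq_trans Cs; apply: leq_trans BC.
- rewrite all_cat; apply/andP; split; apply/allP => s.
    move=> /(allP allB) /andP[Bs sB]; rewrite (leq_trans AB) //=; lia.
  move=> /(allP allC) /andP[Cs sC]; lia.
- by rewrite map_cat big_cat AE prodB prodC.
Qed.

Lemma parses_generates us A ss : parses E us -> map choice_val ss = us ->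
  derives A ss -> generates node leaf A (yield ss).
Proof.
move=> pus; elim: pus A ss => [y yE|u v pu IHu pv IHv uvE] A ss.
  case: ss => [|[i vc] [|//]] // _ [okA _ allA prodA].
  constructor; apply: leafP.
  - by move: okA; rewrite /choices_ok /= andbT.
  - by move: allA; rewrite /= andbT.
  - by move: prodA; rewrite /= big_seq1.
move=> ssE; have [ss1 [ss2 [-> e1 e2]]] : exists ss1 ss2,
    [/\ ss = ss1 ++ ss2, map choice_val ss1 = u & map choice_val ss2 = v].
  exists (take (size u) ss), (drop (size u) ss).
  by rewrite cat_take_drop map_take map_drop ssE take_size_cat ?drop_size_cat.
case: ss2 e2 => [|s ss2] e2; first by have := pv; rewrite -e2 => /parses_neq0.
rewrite /derives /choices_ok all_cat /in_order pairwise_cat all_cat.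
case=> /andP[ok1 ok2] /and3P[ord12 ord1 ord2] /andP[all1 all2] prodA.
rewrite yield_cat.
(* The interval is cut at the factor index of the first choice on the right: by order, no index on
   the left exceeds it and none on the right is smaller. *)
pose B : nonterminal := (SeqSub (parses_prod pu), A.1.2, s.1).
pose C : nonterminal := (SeqSub (parses_prod pv), s.1, A.2).
apply: (@generates_node _ _ _ _ A B C).
- apply/and4P; split=> //=; apply/eqP; rewrite -prodA map_cat e1 e2.
  exact: big_cat.
- apply: IHu => //; split=> //=; last by rewrite e1.
  apply/allP => s' s'1; have /andP[-> _] := allP all1 _ s'1.
  by move/allrelP: ord12; apply; rewrite ?mem_head.
- apply: IHv => //; split=> //=; last by rewrite -e2.
  apply/andP; split; first by rewrite leqnn; case/andP: all2 => /andP[].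
  apply/allP => s' s'2; move: ord2 => /= /andP[/allP/(_ _ s'2) -> _].
  by case/andP: all2 => _ /allP/(_ _ s'2)/andP[].
Qed.

End PowerGrammar.

(** * Sorted sequences of factor indices *)

Section Phases.
Variable n : nat.

Definition phases k : seq 'I_n := flatten [seq nseq k i | i <- enum 'I_n].

Lemma count_phases k i : count_mem i (phases k) = k.
Proof.
rewrite /phases count_flatten -map_comp.
rewrite (eq_map (g := fun j => if j == i then k else 0%N)); last first.
  by move=> j /=; rewrite count_nseq /=; case: eqP => _; rewrite ?mul1n ?mul0n.
rewrite sumnE big_map big_enum /= (bigD1 i) //= eqxx big1 ?addn0 // => j.
by move/negbTE ->.
Qed.

Lemma pairwise_phases k : pairwise (fun i j : 'I_n => (i <= j)%N) (phases k).
Proof.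
have : pairwise (fun i j : 'I_n => (i <= j)%N) (enum 'I_n).
  rewrite -(pairwise_map (@nat_of_ord n) leq) val_enum_ord.
  by rewrite -(sorted_pairwise leq_trans) iota_sorted.
rewrite /phases; elim: (enum 'I_n) => //= i s IH /andP[is_ ps].
rewrite pairwise_cat IH // andbT; apply/andP; split.
  apply/allrelP => a b; rewrite mem_nseq => /andP[_ /eqP ->].
  case/flattenP => _ /mapP[c cs ->]; rewrite mem_nseq => /andP[_ /eqP ->].
  exact: (allP is_).
elim: k {IH ps is_} => //= k ->; rewrite andbT.
by apply/allP => a; rewrite mem_nseq => /andP[_ /eqP ->].
Qed.

(** Recovers the order of the factors from the commutative image, where only counts survive. *)
Lemma phases_uniq k (s : seq 'I_n) : pairwise (fun i j : 'I_n => (i <= j)%N) s ->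
  (forall i, count_mem i s = k) -> s = phases k.
Proof.
move=> ps cs; have trle : transitive (fun i j : 'I_n => (i <= j)%N).
  by move=> a b c; apply: leq_trans.
apply: (sorted_eq trle).
- by move=> a b /= ab; apply/val_inj/eqP; rewrite eqn_leq.
- by rewrite sorted_pairwise.
- by rewrite sorted_pairwise // pairwise_phases.
- by apply/allP => i _ /=; rewrite cs count_phases.
Qed.

End Phases.

Section PowerNorm.
Variables (G : groupType) (X : Type) (f : X -> G) (n : nat).
Variables (g : 'I_n.+1 -> G) (w : 'I_n.+1 -> word X).
Local Notation val := (word_val f).
Local Notation gprod s := (\prod_(y <- s) y)%g.
Hypothesis wE : forall i, val (w i) = g i.
Hypothesis normE : forall u, conj_norm (pm_set f) (val u) =
  enat_inf [set l | exists u', deletion u u' l /\ val u' = 1%g].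

Definition power_word k : word X := flatten [seq w i | i <- phases n.+1 k].

Lemma power_wordE k : val (power_word k) = (\prod_(i < n.+1) g i ^+ k)%g.
Proof.
rewrite word_val_flatten big_map /phases big_flatten big_map.
rewrite [index_enum _]unlock -enumT.
apply: eq_bigr => i _; rewrite big_nseq wE.
by elim: k => //= k ->; rewrite expgS.
Qed.

Lemma power_word_deletion : exists C, forall k,
  deletion (power_word k.+1) (power_word k) C.
Proof.
rewrite /power_word /phases; elim: (enum _) => [|i s [C dC]].
  by exists 0%N => k; constructor.
exists (size (w i) + C)%N => k.
rewrite /= !map_cat !flatten_cat catA; apply: deletion_cat (dC k).
exact: deletion_prefix.
Qed.

Lemma power_norm_Some k : exists l, power_norm (pm_set f) g k = Some l.
Proof.
rewrite /power_norm -power_wordE normE.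
have [[l [-> _ _]]|[_ /(_ (size (power_word k)))[]]] := enat_infP
  [set l | exists u', deletion (power_word k) u' l /\ val u' = 1%g].
  by exists l.
exists [::]; rewrite word_val_nil; split=> //.
by rewrite -[X in deletion X]cats0; apply: deletion_prefix.
Qed.

Lemma power_norm_growth : exists C, forall k l l',
  power_norm (pm_set f) g k = Some l -> power_norm (pm_set f) g k.+1 = Some l' ->
  (l' <= l + C)%N.
Proof.
have [C dC] := power_word_deletion; exists C => k l l'.
rewrite /power_norm -!power_wordE !conj_normE.
have [[x [-> lx _]]|[-> //]] :=
  enat_infP [set l | conj_product (pm_set f) l (val (power_word k))].
move=> [<-].
have [[y [-> _ miny]]|[-> //]] :=
  enat_infP [set l | conj_product (pm_set f) l (val (power_word k.+1))].
move=> [<-]; apply: miny; rewrite addnC -[val _]mul1g.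
by apply: deletion_conj_product (dC k) _; rewrite mul1g.
Qed.

Lemma deletion_choices (D : 'I_n.+1 -> seq (G * nat)) (is_ : seq 'I_n.+1) l v :
  (forall i v c, (v, c) \in D i <-> exists u', deletion (w i) u' c /\ val u' = v) ->
  (exists u', deletion (flatten [seq w i | i <- is_]) u' l /\ val u' = v) <->
  exists ss, [/\ [seq s.1 | s <- ss] = is_, choices_ok D ss,
    gprod (map (@choice_val G n) ss) = v & cost ss = l].
Proof.
move=> DP; elim: is_ l v => [|i is_ IH] l v.
  split=> [[u' [/deletion_nilP[-> ->] <-]]|[[|s ss] [ssE _ <- <-]]] //.
    by exists [::]; rewrite big_nil word_val_nil.
  by exists [::]; rewrite big_nil word_val_nil; split=> //; constructor.
split=> [[u' [/= /deletion_catP[t1 [t2 [l1 [l2 [d1 d2 -> ->]]]]] <-]]|].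
  have /IH[ss [ssE okss prodss costss]] : exists u',
    deletion (flatten [seq w i | i <- is_]) u' l2 /\ val u' = val t2 by exists t2.
  exists ((i, (val t1, l1)) :: ss); split.
  - by rewrite /= ssE.
  - by apply/andP; split=> //; apply/DP; exists t1.
  - by rewrite /= big_cons prodss word_val_cat.
  - by rewrite /cost /= -costss.
case=> -[[//]|[i' [v1 c1]] ss [[-> ssE] /andP[/DP[t1 [d1 t1v]] okss] prodss costss]].
have /IH[t2 [d2 t2v]] : exists ss', [/\ [seq s.1 | s <- ss'] = is_, choices_ok D ss',
    gprod (map (@choice_val G n) ss') = gprod (map (@choice_val G n) ss) &
    cost ss' = cost ss] by exists ss.
exists (t1 ++ t2); rewrite word_val_cat t1v t2v -prodss -costss /= big_cons.
by split=> //; apply: deletion_cat.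
Qed.

Theorem power_norm_semi_arithmetic : virtually_free G ->
  semi_arithmetic (power_norm (pm_set f) g).
Proof.
move=> vfG.
have /choice[D DP] i := finite_deletions f (w i).
pose Y := flatten [seq [seq vc.1 | vc <- D i] | i <- enum 'I_n.+1].
(* 1 is adjoined to [E] because it labels the root nonterminal. *)
have [E [E1 parsesE]] : exists E : seq G, 1%g \in E /\
    forall ys : seq G, {subset ys <= Y} -> gprod ys = 1%g -> ys = [::] \/ parses E ys.
  have [E EP] := virtually_free_parses Y vfG; exists (1%g :: E).
  split=> [|ys ysY ys1]; first exact: mem_head.
  have [|pys] := EP ys ysY ys1; [by left | right].
  by apply: parses_sub pys => y yE; rewrite inE yE orbT.
pose root : seq_sub E * 'I_n.+1 * 'I_n.+1 := (SeqSub E1, ord0, ord_max).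
pose S kl := exists2 y, generates (@node G n E) (leaf D (E := E)) root y /\
  (forall i, y.1 i = y.1 ord0) & kl = (y.1 ord0, y.2).
have slS : semilinear S.
  pose W := ({ffun 'I_n.+1 -> nat} * nat)%type.
  apply: (@semilinear_image W (nat * nat)%type (fun y => (y.1 ord0, y.2))).
  - by rewrite /= ffunE.
  - by move=> x y; rewrite /= ffunE.
  (* The equations between exponents are imposed one coordinate at a time. *)
  have : semilinear (fun y : W => generates (@node G n E) (leaf D (E := E)) root y /\
      forall i, i \in enum 'I_n.+1 -> y.1 i = y.1 ord0).
    elim: (enum _) => [|i s IH].
      apply: semilinear_ext (semilinear_generates (@node G n E) (leaf D (E := E)) root).
      by move=> y; split=> [?|[]//]; split.
    have coord0 (j : 'I_n.+1) : (0 : W).1 j = 0%N by rewrite ffunE.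
    have coordD (j : 'I_n.+1) : {morph (fun y : W => y.1 j) : x y / x + y >-> (x + y)%N}.
      by move=> x y; rewrite /= ffunE.
    apply: semilinear_ext
      (semilinear_kernel (coord0 i) (coordD i) (coord0 ord0) (coordD ord0) IH) => y; split.
      move=> [[gy ys] yi]; split=> // j; rewrite inE => /orP[/eqP->//|]; exact: ys.
    move=> [gy ys]; split; last by apply: ys; rewrite mem_head.
    by split=> // j js; apply: ys; rewrite inE js orbT.
  apply: semilinear_ext => y; split=> -[gy yE]; split=> // i *; apply: yE.
  by rewrite mem_enum.
(* The index 0 is skipped: a bracketing is never empty, so the grammar does not derive the empty
   sequence of choices. *)
apply: (semi_arithmetic_eq (N := 1%N)) (semi_arithmetic_envelope slS) => k k0.
rewrite /power_norm -power_wordE normE; congr enat_inf; apply/seteqP; split=> l /=.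
  case=> y [gy yk] [kE lE].
  have [_ [ss [okss ordss _ prodss] yE]] := generates_derives gy.
  apply/(deletion_choices _ _ _ DP); exists ss; split=> //; last by rewrite lE yE.
  apply: phases_uniq; first by rewrite pairwise_map.
  by move=> i; rewrite kE -(yk i) yE /= ffunE.
case/(deletion_choices _ _ _ DP) => ss [ssE okss prodss costss].
exists (yield ss); last by rewrite /= ffunE ssE count_phases costss.
split; last by move=> i; rewrite /= !ffunE ssE !count_phases.
have [|ss0|] := parsesE (map (@choice_val G n) ss) _ prodss.
- move=> _ /mapP[s sss ->]; apply/flattenP; exists [seq vc.1 | vc <- D s.1].
    by apply/mapP; exists s.1; rewrite ?mem_enum.
  by apply: map_f; apply: (allP okss).
- have := count_phases k (ord0 : 'I_n.+1); rewrite -ssE.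
  by case: ss ss0 {ssE okss prodss costss} => //= _ k0'; rewrite -k0' in k0.
move=> /parses_generates; apply=> //; split=> //.
- rewrite /in_order -(pairwise_map (fun s => s.1) (fun i j : 'I_n.+1 => (i <= j)%N)).
  by rewrite ssE pairwise_phases.
- by apply/allP => s _ /=; rewrite -ltnS ltn_ord.
Qed.

End PowerNorm.

Theorem theorem1p1 (R : realType) (G : groupType) (X : Type) (x : X -> G)
    (hG : freely_generates [set: G] x \/
          (coxeter_presentation x /\ virtually_free G))
    (n : nat) (g : 'I_n -> G) :
  uniformly_semi_arithmetic (power_norm (pm_set x) g) /\
  forall m d : nat,
    uniformly_semi_arithmetic_with m d (power_norm (pm_set x) g) ->
    cvg (power_norm_ratio R (pm_set x) g @ \oo) /\
    tau R (pm_set x) g = (d%:R / m%:R)%:E.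
Proof.
have [presx vfG] :
    (freely_generates [set: G] x \/ coxeter_presentation x) /\ virtually_free G.
  case: hG => [freex|[coxx vfG]]; split=> //; [by left | | by right].
  exact: free_virtually_free freex.
have surjx h : exists w, word_val x w = h.
  case: presx => [freex|[m [_ presx]]]; first exact: (word_surj freex).
  exact: (word_surj presx).
(* The grammar needs a first factor [ord0]; the empty product has norm 0 for every [k]. *)
case: n g => [|n] g.
  have gE k : power_norm (pm_set x) g k = Some 0%N.
    rewrite /power_norm big_ord0 conj_normE; apply: enat_inf_Some => //.
    exact: conj_product0.
  split; last by move=> m d; apply: power_norm_limit gE.
  by exists 1%N, 0%N; split=> // r; exists 0%N => k; rewrite !gE.
have /choice[w wE] i := surjx (g i).
have normE u := conj_norm_word u presx.
have /choice[f fE] := power_norm_Some wE normE.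
split; last by move=> m d; apply: power_norm_limit fE.
have fE' : (fun k => Some (f k)) = power_norm (pm_set x) g.
  by apply/funext => k; rewrite fE.
have [C fC] := power_norm_growth wE.
rewrite -fE'; apply: (@semi_arithmetic_uniform _ C).
  by move=> k; apply: (fC k); rewrite fE.
by rewrite fE'; apply: power_norm_semi_arithmetic wE normE vfG.
Qed.
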